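(* Let $\lambda,\gamma>0$ and let $f_0:\mathbb{R}\to[0,\infty)$, $g_0:\mathbb{R}^2\to[0,\infty)$ be measurable with $$\int_{\mathbb{R}}(1+\varphi^2)f_0\,\mathrm{d}\varphi<\infty,\qquad \int_{\mathbb{R}^2}(1+\varphi^2)g_0\,\mathrm{d}\varphi\,\mathrm{d}\varphi_*<\infty,\qquad g_0(\varphi,\varphi_* )=g_0(\varphi_*,\varphi),$$ and with $M:=\int_{\mathbb{R}}f_0\,\mathrm{d}\varphi+2\int_{\mathbb{R}^2}g_0\,\mathrm{d}\varphi\,\mathrm{d}\varphi_*>0$. Let $$I:=\int_{\mathbb{R}}\varphi f_0\,\mathrm{d}\varphi+2\int_{\mathbb{R}^2}\varphi g_0\,\mathrm{d}\varphi\,\mathrm{d}\varphi_*,\qquad \varphi_\infty:=\frac IM,$$ $$M_{f_\infty}:=\frac{2M}{1+\sqrt{1+8\lambda M/\gamma}},\qquad M_{g_\infty}:=\frac{2M}{1+\sqrt{1+8\lambda M/\gamma}}\cdot\frac{2\lambda M/\gamma}{1+\sqrt{1+8\lambda M/\gamma}}.$$ Then the mild solution $(f(t),g(t))$ of the initial value problem $$\partial_tf=2\Big(\gamma\int_{\mathbb{R}}g\,\mathrm{d}\varphi_*-\lambda f\int_{\mathbb{R}}f(\varphi_*,t)\,\mathrm{d}\varphi_*\Big),\qquad \partial_tg+\nabla\cdot(v_1g)=\lambda f(\varphi,t)f(\varphi_*,t)-\gamma g,$$ $$f(\varphi,0)=f_0(\varphi),\qquad g(\varphi,\varphi_*,0)=g_0(\varphi,\varphi_*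 ),$$ satisfies $$\lim_{t\to\infty}(f(t),g(t))=\left(M_{f_\infty}\delta_{\varphi_\infty},\,M_{g_\infty}\delta_{(\varphi_\infty,\varphi_\infty)}\right)$$ in the sense of distributions.
   Context: Here $f=f(\varphi,t)$, $g=g(\varphi,\varphi_*,t)$ with $\varphi,\varphi_*\in\mathbb{R}$, $\nabla=(\partial_\varphi,\partial_{\varphi_*})$, $v_1(\varphi,\varphi_* )=\frac{\varphi-\varphi_*}{2}(-1,1)$, and $\delta_a$ is the Dirac measure at $a$. The mild solution is the unique $(f,g)\in C([0,\infty);L^1_+(\mathbb{R})\times L^1_+(\mathbb{R}^2))$ ($L^1_+$: nonnegative functions in $L^1$) satisfying, for $t\ge 0$, $$f(\varphi,t)=F(0,t)f_0(\varphi)+2\gamma\int_0^tF(s,t)\int_{\mathbb{R}}g(\varphi,\varphi_*,s)\,\mathrm{d}\varphi_*\,\mathrm{d}s,$$ $$g(\varphi,\varphi_*,t)=(S(t)g_0)(\varphi,\varphi_* )+\lambda\int_0^t\big(S(t-s)[f(\cdot,s)f_*(\cdot,s)]\big)(\varphi,\varphi_* )\,\mathrm{d}s,$$ where $f(\cdot,s)f_*(\cdot,s)$ is the function $(\varphi,\varphi_* )\mapsto f(\varphi,s)f(\varphi_*,s)$, $F(s,t)=\exp(-2\lambda\int_s^tM_f(r)\,\mathrm{d}r)$, and $M_f$ is determined by solving $\dot M_f=2\gamma M_g-2\lambda M_f^2$, $\dot M_g=\lambda M_f^2-\gamma M_g$ with $M_f(0)=\int_{\mathbb{R}} f_0\,\mathrm{d}\varphi$,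 $M_g(0)=\int_{\mathbb{R}^2} g_0\,\mathrm{d}\varphi\,\mathrm{d}\varphi_*$. The semigroup $S(t)$, $t\ge 0$, is $$(S(t)g)(\varphi,\varphi_* )=e^{(1-\gamma)t}g\big(\Phi^{-t}(\varphi,\varphi_* ),\Phi_*^{-t}(\varphi,\varphi_* )\big),$$ with $\Phi^t(\varphi,\varphi_* )=\frac{\varphi+\varphi_*}{2}+e^{-t}\frac{\varphi-\varphi_*}{2}$ and $\Phi^t_*(\varphi,\varphi_* )=\frac{\varphi+\varphi_*}{2}+e^{-t}\frac{\varphi_*-\varphi}{2}$ for $t\in\mathbb{R}$. *)

(* Defs.v *)
From HB Require Import structures.
From mathcomp Require Import all_boot all_order all_algebra.
From mathcomp Require Import all_classical all_reals all_analysis.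
Set Implicit Arguments.
Unset Strict Implicit.
Unset Printing Implicit Defensive.
Import Order.TTheory GRing.Theory Num.Theory.
Import numFieldNormedType.Exports.
Local Open Scope classical_set_scope.
Local Open Scope ring_scope.

Definition leb1 (R : realType) : {measure set (measurableTypeR R) -> \bar R} :=
  lebesgue_measure.

Definition leb2 (R : realType) :
    {measure set (measurableTypeR R * measurableTypeR R) -> \bar R} :=
  (lebesgue_measure \x lebesgue_measure)%E.

(* On a finite-dimensional space the following is the usual C^k: existence and
   continuity of all iterated directional derivatives up to order k is the same
   as that of all iterated partial derivatives. *)
Fixpoint Ck (R : realType) (V : normedModType R) (k : nat) (psi : V -> R) : Prop :=
  continuous psi /\
  if k is k'.+1 then
    forall v : V, (forall x, derivable psi x v) /\ Ck k' (fun x => 'D_v psi x)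
  else True.

(* C_c^oo; real-valued test functions suffice as the densities are real. *)
Definition test_function (R : realType) (V : normedModType R) (psi : V -> R) : Prop :=
  (forall k, Ck k psi) /\
  exists K : set V, compact K /\ forall x, ~ K x -> psi x = 0.

(* (Phi^t, Phi_*^t) *)
Definition flow (R : realType) (t : R) (p : R * R) : R * R :=
  ((p.1 + p.2) / 2 + expR (- t) * ((p.1 - p.2) / 2),
   (p.1 + p.2) / 2 + expR (- t) * ((p.2 - p.1) / 2)).

Definition semigroup (R : realType) (gamma t : R) (g : R * R -> R) : R * R -> R :=
  fun p => expR ((1 - gamma) * t) * g (flow (- t) p).

(* The ODE holds on ]0, +oo[ with Mf, Mg continuous up to t = 0; values at
   negative times are irrelevant. *)
Definition mass_system (R : realType) (lambda gamma : R) (f0 : R -> R)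
    (g0 : R * R -> R) (Mf Mg : R -> R) : Prop :=
  [/\ {within `[0, +oo[, continuous Mf} /\ {within `[0, +oo[, continuous Mg},
      forall t : R, 0 < t ->
        is_derive t 1 Mf (2 * gamma * Mg t - 2 * lambda * Mf t ^+ 2),
      forall t : R, 0 < t ->
        is_derive t 1 Mg (lambda * Mf t ^+ 2 - gamma * Mg t),
      Mf 0 = \int[leb1 R]_x f0 x
    & Mg 0 = \int[leb2 R]_p g0 p].

Definition decay (R : realType) (lambda : R) (Mf : R -> R) (s t : R) : R :=
  expR (- (2 * lambda * \int[leb1 R]_(r in `[s, t]) Mf r)).

(* h, restricted to t >= 0, represents an element of C([0,oo); L^1_+(mu)): for
   every t the class of h t is in L^1 and is nonnegative, and t |-> h t is
   continuous for the L^1 norm. *)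
Definition continuous_L1_plus (R : realType) (d : measure_display)
    (T : measurableType d) (mu : {measure set T -> \bar R}) (h : R -> T -> R) : Prop :=
  [/\ forall t : R, 0 <= t -> h t \in Lfun mu 1,
      forall t : R, 0 <= t -> {ae mu, forall x, 0 <= h t x}
    & forall t0 : R, 0 <= t0 ->
        ('N[mu]_1 [EFin \o (h t \- h t0)%R])%E @[t --> within `[0, +oo[ (nbhs t0)]
          --> 0%E].

(* f t x = f(x, t) and g t (x, y) = g(x, y, t).  Elements of L^1 are given by
   representatives, so the equations hold almost everywhere for each t; joint
   measurability in time and state, which every curve in C([0,oo); L^1) has for
   a suitable choice of representatives, makes the time integrals meaningful
   pointwise.  All integrals in the equations are of (a.e.) nonnegative
   functions and are taken in [0, +oo]. *)
Definition mild_solution (R : realType) (lambda gamma : R) (f0 : R -> R)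
    (g0 : R * R -> R) (f : R -> R -> R) (g : R -> R * R -> R) : Prop :=
  [/\ continuous_L1_plus (leb1 R) f /\ continuous_L1_plus (leb2 R) g,
      measurable_fun ((`[0, +oo[ : set (measurableTypeR R)) `*` setT)
        (fun q : measurableTypeR R * measurableTypeR R => f q.1 q.2),
      measurable_fun ((`[0, +oo[ : set (measurableTypeR R)) `*` setT)
        (fun q : measurableTypeR R * (measurableTypeR R * measurableTypeR R) =>
           g q.1 q.2)
    & exists Mf Mg : R -> R,
      [/\ mass_system lambda gamma f0 g0 Mf Mg,
          forall t : R, 0 <= t -> {ae leb1 R, forall x,
            (f t x)%:E = (decay lambda Mf 0 t * f0 x)%:E +
              (2 * gamma)%:E * \int[leb1 R]_(s in `[0%R, t])
                ((decay lambda Mf s t)%:E * \int[leb1 R]_y (g s (x, y))%:E)}%E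
        & forall t : R, 0 <= t -> {ae leb2 R, forall p,
            (g t p)%:E = (semigroup gamma t g0 p)%:E +
              lambda%:E * \int[leb1 R]_(s in `[0%R, t])
                (semigroup gamma (t - s) (fun q => f s q.1 * f s q.2) p)%:E}%E]].

(* Main.v *)
Require Import Defs.
From HB Require Import structures.
From mathcomp Require Import all_boot all_order all_algebra.
From mathcomp Require Import all_classical all_reals all_analysis.
From mathcomp Require Import measurable_realfun ring lra.
Set Implicit Arguments.
Unset Strict Implicit.
Unset Printing Implicit Defensive.
Import Order.TTheory GRing.Theory Num.Theory.
Import numFieldNormedType.Exports.
Local Open Scope classical_set_scope.
Local Open Scope ring_scope.

(** Bound pairs contract towards their mean while mass is for ever exchanged
    between single and bound states, so that everything collapses to the common
    barycentre. This is visible in a closed system of moments. For a centre [c]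
    let

      V = int (x - c)^2 f,            P = int (x - c) f,
      Am = int ((x + y)/2 - c)^2 g,   G = int ((x + y)/2 - c) g,
      Dd = int ((x - y)/2)^2 g.

    The flow fixes the mean of a pair and multiplies its half-difference by
    [expR (- t)], and the moments of the source [f f_*] are polynomials in those
    of [f]; hence

      V'  = - 2 lambda Mf V + 2 gamma (Am + Dd),
      Am' = - gamma Am + lambda (V Mf + P^2) / 2,
      Dd' = - (gamma + 2) Dd + lambda (V Mf - P^2) / 2,
      P'  = - 2 lambda Mf P + 2 gamma G,
      G'  = - gamma G + lambda Mf P.

    The quantity P + 2 G is conserved and vanishes for [c = phi_oo]. Then
    P' = - (2 lambda Mf + gamma) P, and a combination of V, Am, Dd and P^2 is a
    Lyapunov function that decays exponentially ([second_moment_cvg0]). The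
    masses are the given pair [(Mf, Mg)] ([massesE]); as Mf + 2 Mg is conserved,
    Mf solves a scalar Riccati equation and tends to its positive stationary
    point ([Mf_cvg], [Mg_cvg]). Converging masses and vanishing second moments
    give the limit of the integrals of bounded continuous functions
    ([concentration_cvg]).

    The system of moments has to be derived from the mild equations, which hold
    only almost everywhere and for unspecified representatives. [pos_rep_fE] and
    [pos_rep_gE] provide representatives that are nonnegative everywhere and
    jointly measurable in time and state. For these, Tonelli's theorem and the
    change of variables along the flow give the equations tested against any
    nonnegative weight ([weak_f], [weak_g]). The finiteness of the second moments
    at positive times is not part of the notion of solution: it follows from a
    Gronwall inequality for the truncated weights min(x^2, n) that is uniform in
    n ([truncated_second_moments]). *)

(** * Linear equations and Gronwall inequalities on the half-line *)

Section HalfLine.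
Context {R : realType}.
Implicit Types u v a b k A : R -> R.
Local Notation mu := (@lebesgue_measure R).
Local Notation "'cont0' u" := {within `[0, +oo[, continuous u}
  (at level 10, u at level 9).

Lemma cont0_itv u (T : R) : cont0 u -> {within `[0, T], continuous u}.
Proof.
apply: continuous_subspaceW => x /=; rewrite !in_itv/= => /andP[-> _].
by [].
Qed.

Lemma cont0_pos u (t : R) : cont0 u -> 0 < t -> {for t, continuous u}.
Proof.
move=> /continuous_within_itvcyP[h _] t0; apply: h.
by rewrite in_itv/= t0.
Qed.

Lemma cont0_eq u v : (forall t : R, 0 <= t -> u t = v t) -> cont0 u -> cont0 v.
Proof.
move=> uv; apply: subspace_eq_continuous => t; rewrite inE/= in_itv/= andbT.
exact: uv.
Qed.

Lemma cont0_measurable u : cont0 u ->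
  measurable_fun (`[0, +oo[ : set (measurableTypeR R)) u.
Proof. exact: subspace_continuous_measurable_fun. Qed.

Lemma cont0D u v : cont0 u -> cont0 v -> cont0 (fun t : R => u t + v t).
Proof. by move=> cu cv t; apply: cvgD; [exact: cu|exact: cv]. Qed.

Lemma cont0N u : cont0 u -> cont0 (fun t : R => - u t).
Proof. by move=> cu t; apply: cvgN; exact: cu. Qed.

Lemma cont0M u v : cont0 u -> cont0 v -> cont0 (fun t : R => u t * v t).
Proof. by move=> cu cv t; apply: cvgM; [exact: cu|exact: cv]. Qed.

Lemma cont0_cst (k : R) : cont0 (fun _ : R => k).
Proof. by move=> t; exact: cvg_cst. Qed.

Lemma cont0_comp (h : R -> R) u : continuous h -> cont0 u ->
  cont0 (fun t : R => h (u t)).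
Proof.
move=> ch cu t; have H := cvg_comp _ _ (cu t) (ch (u t)); exact: H.
Qed.

Lemma cont0_id : cont0 (fun t : R => t).
Proof. by apply: continuous_subspaceT => t; exact: cvg_id. Qed.

Lemma nonincreasing_after u u' (T : R) : 0 <= T -> cont0 u ->
  (forall t : R, 0 < t -> is_derive t 1 u (u' t)) ->
  (forall t : R, T < t -> u' t <= 0) -> forall t : R, T <= t -> u t <= u T.
Proof.
move=> T0 cu du u'0 t Tt.
have ct : {within `[T, t], continuous u}.
  apply: continuous_subspaceW cu => x /=; rewrite !in_itv/= => /andP[Tx _].
  by rewrite (le_trans T0 Tx).
have dt x : x \in `]T, t[ -> is_derive x 1 u (u' x).
  by rewrite in_itv/= => /andP[Tx _]; apply: du; exact: le_lt_trans Tx.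
apply: (@ler0_derive1_le_cc R u T t) => //.
- by move=> x /dt [].
- move=> x xTt; have := dt _ xTt => dx; rewrite derive1E derive_val u'0//.
  by move: xTt; rewrite in_itv/= => /andP[].
- by rewrite in_itv/= lexx Tt.
- by rewrite in_itv/= lexx Tt.
Qed.

Lemma continuous0_integrable u (T : R) : cont0 u ->
  mu.-integrable `[0, T] (EFin \o u).
Proof.
by move=> cu; apply: continuous_compact_integrable;
  [exact: segment_compact|exact: cont0_itv].
Qed.

Lemma primitive_continuous u :
  (forall T, mu.-integrable `[0, T] (EFin \o u)) ->
  cont0 (fun t : R => \int[mu]_(s in `[0, t]) u s).
Proof.
move=> iu; apply/continuous_within_itvcyP; split.
  move=> t; rewrite in_itv/= andbT => t0.
  have t10 : 0 <= t + 1 by rewrite addr_ge0// ltW.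
  have := parameterized_integral_continuous t10 (iu (t + 1)).
  move/continuous_within_itvP => /(_ _)[|]; first lra.
  move=> + _ _; apply; rewrite in_itv/=; apply/andP; split; lra.
have := parameterized_integral_continuous ler01 (iu 1).
move/continuous_within_itvP => /(_ _)[|]; first lra.
by [].
Qed.

Lemma primitive_derive u (t : R) : cont0 u -> 0 < t ->
  is_derive t 1 (fun t => \int[mu]_(s in `[0, t]) u s) (u t).
Proof.
move=> cu t0.
have t1 : t < t + 1 by rewrite ltrDl.
have := continuous_FTC1_closed t1 (continuous0_integrable _ cu) t0.
move=> /(_ (cont0_pos cu t0))[dF <-].
by rewrite derive1E; exact/derivableP.
Qed.

Lemma constant_halfline u : cont0 u ->
  (forall t : R, 0 < t -> is_derive t 1 u 0) -> forall t : R, 0 <= t -> u t = u 0.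
Proof.
move=> cu du t t0.
have dNu (s : R) : 0 < s -> is_derive s 1 (fun s => - u s) 0.
  by move=> s0; have := is_deriveN (du s s0); rewrite oppr0.
apply/eqP; rewrite eq_le.
rewrite (nonincreasing_after (lexx 0) cu du (fun _ _ => lexx 0) t0)/= -lerN2.
exact: (nonincreasing_after (lexx 0) (cont0N cu) dNu (fun _ _ => lexx 0) t0).
Qed.

(** The exponential with exponent [- (A t - A s)] is the propagator from time
    [s] to time [t] of the linear equation with rate [A']. *)
Definition duhamel A (u0 : R) b (t : R) : R :=
  expR (- A t) * u0 + \int[mu]_(s in `[0, t]) (expR (- (A t - A s)) * b s).

(** With the variables [s] and [t] of the propagator separated, continuity and
    differentiability reduce to those of a primitive. *)
Lemma duhamel_factor A (u0 : R) b (t : R) :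
  mu.-integrable `[0, t] (EFin \o (fun s => expR (A s) * b s)) ->
  duhamel A u0 b t =
    expR (- A t) * (u0 + \int[mu]_(s in `[0, t]) (expR (A s) * b s)).
Proof.
move=> ib; rewrite /duhamel mulrDr; congr (_ + _).
rewrite -RintegralZl//; apply: eq_Rintegral => s _.
by rewrite mulrA -expRD opprB addrC.
Qed.

Lemma integrable_expM A b (T : R) : cont0 A -> mu.-integrable `[0, T] (EFin \o b) ->
  mu.-integrable `[0, T] (EFin \o (fun s => expR (A s) * b s)).
Proof.
move=> cA ib.
have cE : {within `[0, T], continuous (expR \o A)}.
  by apply: cont0_itv; apply: cont0_comp cA; exact: continuous_expR.
have mE : measurable_fun (`[0, T] : set (measurableTypeR R)) (expR \o A).
  exact: subspace_continuous_measurable_fun.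
suff : mu.-integrable `[0, T] ((EFin \o (expR \o A)) \* (EFin \o b))%E by [].  
apply: integrableMr => //.
have /compact_bounded[M [_ mrt]] := continuous_compact cE (@segment_compact R 0 T).
by exists M; split; rewrite ?num_real // => ? ? ? ?; exact: mrt.
Qed.

Lemma integrable_duhamel A b (t : R) : cont0 A ->
  mu.-integrable `[0, t] (EFin \o b) ->
  mu.-integrable `[0, t] (EFin \o (fun s => expR (- (A t - A s)) * b s)).
Proof.
move=> cA ib; have iE := integrable_expM cA ib.
have mI : measurable (`[0, t] : set (measurableTypeR R)) by exact: measurable_itv.
apply: eq_integrable (integrableZl mI (expR (- A t)) iE) => //.
by move=> s _; rewrite /= -EFinM mulrA -expRD opprB addrC.
Qed.

Lemma is_derive_expN A (t a : R) : is_derive t 1 A a ->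
  is_derive t 1 (fun s : R => expR (- A s)) (- a * expR (- A t)).
Proof.
move=> dA; have dN := is_deriveN dA.
have := is_derive1_comp (is_derive_expR _) dN.
by move=> /is_derive_eq; apply; rewrite mulrC.
Qed.

Lemma duhamel_continuous A (u0 : R) b : cont0 A ->
  (forall T, mu.-integrable `[0, T] (EFin \o b)) -> cont0 (duhamel A u0 b).
Proof.
move=> cA ib.
have iAb (T : R) := integrable_expM cA (ib T).
apply: (@cont0_eq (fun t => expR (- A t) *
    (u0 + \int[mu]_(s in `[0, t]) (expR (A s) * b s)))).
  by move=> t _; rewrite duhamel_factor.
apply: cont0M; first by apply: cont0_comp (cont0N cA); exact: continuous_expR.
by apply: cont0D; [exact: cont0_cst|exact: primitive_continuous].
Qed.

Lemma duhamel_derive A a (u0 : R) b (t : R) : cont0 A ->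
  (forall t : R, 0 < t -> is_derive t 1 A (a t)) -> cont0 b -> 0 < t ->
  is_derive t 1 (duhamel A u0 b) (- a t * duhamel A u0 b t + b t).
Proof.
move=> cA dA cb t0.
have iAb (T : R) := integrable_expM cA (continuous0_integrable T cb).
have cAb : cont0 (fun s => expR (A s) * b s).
  by apply: cont0M => //; apply: cont0_comp cA; exact: continuous_expR.
have -> : duhamel A u0 b = (fun t => expR (- A t) *
    (u0 + \int[mu]_(s in `[0, t]) (expR (A s) * b s))).
  by apply/funext => s; rewrite duhamel_factor.
have dE := is_derive_expN (dA t t0).
have dI := is_deriveD (is_derive_cst u0 t 1) (primitive_derive cAb t0).
have := is_deriveM dE dI; move=> /is_derive_eq; apply.
rewrite fctE /GRing.scale/= add0r mulrA -expRD addNr expR0 mul1r.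
by rewrite [RHS]addrC; congr (_ + _); rewrite /cst/=; ring.
Qed.

Lemma is_derive_scale (k t : R) : is_derive t 1 (fun s : R => k * s) k.
Proof.
have := is_deriveZ k (is_derive_id t (1 : R)).
by move=> /is_derive_eq; apply; rewrite /GRing.scale/= mulr1.
Qed.

Lemma cont0_scale (k : R) : cont0 (fun s : R => k * s).
Proof. by apply: cont0M; [exact: cont0_cst|exact: cont0_id]. Qed.

Lemma integrating_factor u u' A a (T : R) : 0 <= T -> cont0 u ->
  (forall t : R, 0 < t -> is_derive t 1 u (u' t)) -> cont0 A ->
  (forall t : R, 0 < t -> is_derive t 1 A (a t)) ->
  (forall t : R, T < t -> u' t <= a t * u t) ->
  forall t : R, T <= t -> u t * expR (- A t) <= u T * expR (- A T).
Proof.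
move=> T0 cu du cA dA u'a.
pose z (t : R) := u t * expR (- A t).
pose z' (t : R) := (u' t - a t * u t) * expR (- A t).
apply: (@nonincreasing_after z z') => //.
- apply: cont0M cu _; apply: cont0_comp (cont0N cA); exact: continuous_expR.
- move=> t t0; have := is_deriveM (du t t0) (is_derive_expN (dA t t0)).
  move=> /is_derive_eq; apply; rewrite /GRing.scale/= /z'; ring.
- by move=> t Tt; rewrite /z' pmulr_lle0 ?expR_gt0// subr_le0 u'a.
Qed.

(** The decay is asked for beyond [T] only: in the application its rate is
    governed by the mass of [f], which is bounded below at late times. *)
Lemma exponential_bound u u' (c T : R) : 0 <= T -> cont0 u ->
  (forall t : R, 0 < t -> is_derive t 1 u (u' t)) ->
  (forall t : R, T < t -> u' t <= - c * u t) ->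
  forall t : R, T <= t -> u t <= u T * expR (- (c * (t - T))).
Proof.
move=> T0 cu du u'c t Tt.
have := integrating_factor T0 cu du (@cont0_scale (- c))
  (fun t _ => is_derive_scale (- c) t) u'c Tt.
rewrite -ler_pdivlMr ?expR_gt0// -mulrA -expRN -expRD => /le_trans; apply.
by rewrite le_eqVlt; apply/orP; left; apply/eqP; congr (_ * expR _); ring.
Qed.

Lemma gronwall_integral u (C K : R) : 0 < K -> cont0 u ->
  (forall t : R, 0 <= t -> u t <= C + K * \int[mu]_(s in `[0, t]) u s) ->
  forall t : R, 0 <= t -> u t <= C * expR (K * t).
Proof.
move=> K0 cu uI t t0.
(* The derivative [u] of [U] is at most [K * U]. *)
pose U (t : R) := C / K + \int[mu]_(s in `[0, t]) u s.
have cU : cont0 U.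
  apply: cont0D; first exact: cont0_cst.
  by apply: primitive_continuous => T; exact: continuous0_integrable.
have dU (x : R) : 0 < x -> is_derive x 1 U (u x).
  move=> x0; have := is_deriveD (is_derive_cst (C / K) x 1) (primitive_derive cu x0).
  by move=> /is_derive_eq; apply; rewrite add0r.
have KU (x : R) : K * U x = C + K * \int[mu]_(s in `[0, x]) u s.
  by rewrite /U mulrDr mulrC divfK// gt_eqF.
have uKU (x : R) : 0 <= x -> u x <= K * U x by move=> x0; rewrite KU uI.
have U0 : U 0 = C / K by rewrite /U set_itv1 Rintegral_set1 addr0.
have := integrating_factor (lexx 0) cU dU (@cont0_scale K)
  (fun t _ => is_derive_scale K t) (fun x x0 => uKU x (ltW x0)) t0.
rewrite mulr0 oppr0 expR0 mulr1 U0 -ler_pdivlMr ?expR_gt0// -expRN opprK => UC.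
apply: (le_trans (uKU _ t0)).
by rewrite -ler_pdivlMl// mulrA [K^-1 * C]mulrC.
Qed.

Lemma gronwall_null u u' k : cont0 u ->
  (forall t : R, 0 < t -> is_derive t 1 u (u' t)) -> cont0 k -> u 0 = 0 ->
  (forall t : R, 0 < t -> u' t <= k t * u t) ->
  forall t : R, 0 <= t -> u t <= 0.
Proof.
move=> cu du ck u0 u'k t t0.
have cI : cont0 (fun t => \int[mu]_(s in `[0, t]) k s).
  by apply: primitive_continuous => T; exact: continuous0_integrable.
have := integrating_factor (lexx 0) cu du cI
  (fun t t0 => primitive_derive ck t0) u'k t0.
by rewrite u0 mul0r -ler_pdivlMr ?expR_gt0// mul0r.
Qed.

Lemma eq_duhamel A (u0 : R) b b' (t : R) : (forall s, 0 <= s -> b s = b' s) ->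
  duhamel A u0 b t = duhamel A u0 b' t.
Proof.
move=> bb'; rewrite /duhamel; congr (_ + _); apply: eq_Rintegral => s.
by rewrite inE/= in_itv/= => /andP[s0 _]; rewrite bb'.
Qed.

Lemma duhamel_eq_continuous A (u0 : R) b u : cont0 A ->
  (forall T, mu.-integrable `[0, T] (EFin \o b)) ->
  (forall t : R, 0 <= t -> u t = duhamel A u0 b t) -> cont0 u.
Proof.
move=> cA ib uE; apply: (@cont0_eq (duhamel A u0 b)); last exact: duhamel_continuous.
by move=> t t0; rewrite uE.
Qed.

Lemma duhamel_eq_derive A a (u0 : R) b u (t : R) : cont0 A ->
  (forall t : R, 0 < t -> is_derive t 1 A (a t)) -> cont0 b ->
  (forall t : R, 0 <= t -> u t = duhamel A u0 b t) -> 0 < t ->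
  is_derive t 1 u (- a t * u t + b t).
Proof.
move=> cA dA cb uE t0; rewrite uE ?ltW//.
apply: near_eq_is_derive (duhamel_derive u0 cA dA cb t0).
near=> s; apply/esym/uE/ltW; near: s; exact: lt_nbhsr.
Unshelve. all: by end_near. Qed.

Lemma exponential_cvg0 u (c C T : R) : 0 < c ->
  (forall t : R, T <= t -> 0 <= u t <= C * expR (- (c * (t - T)))) ->
  u t @[t --> +oo] --> 0.
Proof.
move=> c0 uC.
apply: (@squeeze_cvgr _ _ _ _ (fun=> 0) (fun t => C * expR (- (c * (t - T))))).
- by near=> t; apply: uC; near: t; apply: nbhs_pinfty_ge; rewrite num_real.
- exact: cvg_cst.
- rewrite -[X in _ --> X](mulr0 C); apply: cvgM; first exact: cvg_cst.
  apply: (cvg_comp _ _ _ (@cvgr_expR R)).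
  apply: gt0_cvgMry => //.
  exact: (@cvg_addrr R (- T)).
Unshelve. all: by end_near. Qed.
End HalfLine.

(** * Null sets and integrals on products *)

Section TonelliTools.
Local Open Scope ereal_scope.
Context d1 d2 (T1 : measurableType d1) (T2 : measurableType d2) (R : realType).
Variable m1 : {sigma_finite_measure set T1 -> \bar R}.
Variable m2 : {sigma_finite_measure set T2 -> \bar R}.

Section Tonelli.
Variables (D : set T1) (K : T1 * T2 -> \bar R).
Hypotheses (mD : measurable D) (mK : measurable_fun setT K).
Hypothesis K0 : forall q, 0 <= K q.

Let KD (q : T1 * T2) := (K \_ (D `*` setT)) q.

Let mKD : measurable_fun setT KD.
Proof.
have mDT : measurable (D `*` [set: T2]) by exact: measurableX.
have mKDT : measurable_fun (D `*` setT) K by exact: measurable_funTS.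
exact: ((measurable_restrictT K mDT).1 mKDT).
Qed.

Let KD0 q : 0 <= KD q.
Proof. by rewrite /KD patchE; case: ifP. Qed.

Let KDE x : \int[m1]_(s in D) K (s, x) = \int[m1]_s KD (s, x).
Proof.
rewrite integral_mkcond; apply: eq_integral => s _.
by rewrite /KD !patchE in_setX in_setT andbT.
Qed.

Lemma measurable_fun_integral_on :
  measurable_fun setT (fun x => \int[m1]_(s in D) K (s, x)).
Proof.
under eq_fun do rewrite KDE.
exact: (measurable_fun_fubini_tonelli_G KD mKD KD0).
Qed.

Lemma tonelli_on : \int[m2]_x \int[m1]_(s in D) K (s, x) =
  \int[m1]_(s in D) \int[m2]_x K (s, x).
Proof.
under eq_integral do rewrite KDE.
rewrite -(fubini_tonelli KD mKD KD0) [RHS]integral_mkcond.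
apply: eq_integral => s _; rewrite patchE; case: ifPn => sD.
  by apply: eq_integral => x _; rewrite /KD patchE in_setX sD in_setT.
apply: integral0_eq => x _.
by rewrite /KD patchE in_setX (negbTE sD).
Qed.
End Tonelli.

Lemma ae_xsection (P : T1 * T2 -> Prop) : {ae m1 \x m2, forall q, P q} ->
  {ae m1, forall x, {ae m2, forall y, P (x, y)}}.
Proof.
move=> [N [mN N0 PN]].
have : \int[m1]_x `|m2 (xsection N x)| = 0.
  by rewrite -[RHS]N0; apply: eq_integral => x _; rewrite gee0_abs.
move=> /(ae_eq_integral_abs m1 measurableT (measurable_fun_xsection m2 mN)).
apply: filterS => x /(_ I) /= N0x.
exists (xsection N x); split => //; first exact: measurable_xsection.
by move=> y /= Pxy; apply/xsectionP; exact: PN.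
Qed.

(** A measurable set with null sections in one direction is null for the product,
    hence has null sections in the other. This turns an identity that holds at
    each time almost everywhere in the state into one that holds, for almost
    every state, at almost all times. *)
Lemma ae_ysection (P : T1 * T2 -> Prop) : measurable (P : set (T1 * T2)) ->
  (forall x, {ae m2, forall y, P (x, y)}) ->
  {ae m2, forall y, {ae m1, forall x, P (x, y)}}.
Proof.
move=> mP Px; set N := ~` (P : set (T1 * T2)).
have mN : measurable N by exact: measurableC.
have N0 x : m2 (xsection N x) = 0.
  apply: (measure_negligible (measurable_xsection x mN)).
  by apply: negligibleS (Px x) => y /xsectionP.
have : \int[m2]_y `|m1 (ysection N y)| = 0.
  transitivity (\int[m2]_y m1 (ysection N y)).
    by apply: eq_integral => y _; rewrite gee0_abs.
  have := indic_fubini_tonelli m1 m2 mN.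
  rewrite (indic_fubini_tonelli_FE m2 mN) (indic_fubini_tonelli_GE m1 mN) => <-.
  by apply: integral0_eq => x _ /=.
move=> /(ae_eq_integral_abs m2 measurableT (measurable_fun_ysection m1 mN)).
apply: filterS => y /(_ I) /= N0y.
exists (ysection N y); split => //; first exact: measurable_ysection.
by move=> x /= Pxy; apply/ysectionP.
Qed.
End TonelliTools.

Section LebesguePlane.
Context {R : realType}.
Local Notation mu := (@lebesgue_measure R).
Local Notation TR := (measurableTypeR R).
Local Open Scope ereal_scope.

(** The product has a name of its own in order to carry the sigma-finite
    structure under which it can in turn be a factor of a product. *)
Definition lebesgue2 : set (TR * TR) -> \bar R := mu \x mu.

HB.instance Definition _ := Measure.on lebesgue2.

Let lebesgue2_sigma_finite : sigma_finite setT lebesgue2.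
Proof.
have [F FT Foo] := sigma_finiteT mu.
pose e (n : nat) : nat * nat := odflt (0, 0)%N (unpickle n).
have e_surj p : exists n, e n = p by exists (pickle p); rewrite /e pickleK.
exists (fun n => F (e n).1 `*` F (e n).2) => [|n].
  apply/esym; rewrite -subTset => -[x y] _.
  have [i _ Fx] : (\bigcup_n F n) x by rewrite -FT.
  have [j _ Fy] : (\bigcup_n F n) y by rewrite -FT.
  by have [n en] := e_surj (i, j); exists n => //; rewrite en.
have [mF1 F1oo] := Foo (e n).1; have [mF2 F2oo] := Foo (e n).2.
split; first exact: measurableX.
by rewrite /lebesgue2 product_measure1E// lte_mul_pinfty// ge0_fin_numE.
Qed.

HB.instance Definition _ := Measure_isSigmaFinite.Build _ _ _ lebesgue2
  lebesgue2_sigma_finite.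
End LebesguePlane.

(** * The flow as a change of variables *)

Section ChangeOfVariables.
Context {R : realType}.
Local Notation mu := (@lebesgue_measure R).
Local Notation TR := (measurableTypeR R).
Local Notation TRR := (measurableTypeR R * measurableTypeR R)%type.
Local Open Scope ereal_scope.

(** The image of Lebesgue measure under the affine map, scaled by [a], has the
    lengths of intervals as values, so it is Lebesgue measure by uniqueness. *)
Lemma ge0_integral_affine (a b : R) (h : TR -> \bar R) : (0 < a)%R ->
  measurable_fun setT h -> (forall x, 0 <= h x) ->
  \int[mu]_x h (a * x + b)%R = (a^-1)%:E * \int[mu]_x h x.
Proof.
move=> a0 mh h0.
pose phi := (fun x => a * x + b)%R : TR -> TR.
have mphi : measurable_fun setT phi.
  by apply: measurable_funD => //; apply: measurable_funM.
have a0' : (0 <= a^-1)%R by rewrite invr_ge0 ltW.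
rewrite -[LHS](@ge0_integral_pushforward _ _ _ _ _ phi mphi mu setT h)//.
pose a' := NngNum (ltW a0).
have meas (A : set TR) : measurable A ->
    mu A = mscale a' (pushforward mu phi) A.
  apply: lebesgue_measure_unique => _ [[c d] _ <-].
  rewrite -[RHS]/(a%:E * mu (phi @^-1` `]c, d]%classic)).
  have -> : phi @^-1` `]c, d]%classic = `]((c - b) / a)%R, ((d - b) / a)%R]%classic.
    apply/seteqP; split => x /=; rewrite !in_itv/= /phi => /andP[cx xd];
      apply/andP; split.
    - by rewrite ltr_pdivrMr// mulrC ltrBlDr.
    - by rewrite ler_pdivlMr// mulrC lerBrDr.
    - by move: cx; rewrite ltr_pdivrMr// mulrC ltrBlDr.
    - by move: xd; rewrite ler_pdivlMr// mulrC lerBrDr.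
  rewrite !lebesgue_measure_itv/= !lte_fin ltr_pM2r ?invr_gt0// ltrD2r.
  case: ifP => _; last by rewrite mule0.
  by rewrite -!EFinB -EFinM -mulrBl mulrC divfK ?gt_eqF// opprB addrA subrK.
have E : \int[mu]_x h x = a%:E * \int[pushforward mu phi]_x h x.
  rewrite -(ge0_integral_mscale _ _ a')//.
  by apply: eq_measure_integral => A mA _; exact: (meas mphi).
by rewrite E muleA -EFinM mulVf ?gt_eqF// mul1e.
Qed.

Local Notation mu2 := (mu \x mu).

Lemma ge0_integral_swap (h : TRR -> \bar R) : measurable_fun setT h ->
  (forall p, 0 <= h p) -> \int[lebesgue2]_p h (p.2, p.1) = \int[lebesgue2]_p h p.
Proof.
move=> mh h0; rewrite /lebesgue2 (fubini_tonelli2 h)// fubini_tonelli1//.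
by apply: measurableT_comp => //; exact: measurable_swap.
Qed.

Lemma measurable_expR_comp d (T : measurableType d) (h : T -> R) :
  measurable_fun setT h -> measurable_fun setT (fun x => expR (h x)).
Proof.
by move=> mh; apply: measurableT_comp => //; exact: measurable_expR.
Qed.

Lemma measurable_flow_comp d (T : measurableType d) (tau : T -> R)
    (h : T -> TRR) : measurable_fun setT tau -> measurable_fun setT h ->
  measurable_fun setT (fun x => flow (tau x) (h x)).
Proof.
move=> mtau mh.
have m1 : measurable_fun setT (fun x => (h x).1) by exact: measurableT_comp.
have m2 : measurable_fun setT (fun x => (h x).2) by exact: measurableT_comp.
have me : measurable_fun setT (fun x => expR (- tau x)).
  by apply: measurable_expR_comp; exact: measurableT_comp.
apply: measurable_fun_pair => /=.
  apply: measurable_funD; last apply: measurable_funM => //.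
    by apply: measurable_funM => //; exact: measurable_funD.
  by apply: measurable_funM => //; exact: measurable_funB.
apply: measurable_funD; last apply: measurable_funM => //.
  by apply: measurable_funM => //; exact: measurable_funD.
by apply: measurable_funM => //; exact: measurable_funB.
Qed.

Lemma measurable_flow (t : R) : measurable_fun setT (flow t : TRR -> TRR).
Proof. exact: measurable_flow_comp. Qed.

Lemma flowK (t : R) : cancel (flow t) (flow (- t)).
Proof.
move=> [x y]; rewrite /flow/= opprK.
have E : (expR t * expR (- t) = 1)%R by rewrite -expRD subrr expR0.
congr (_, _).
  transitivity ((x + y) / 2 + (expR t * expR (- t)) * ((x - y) / 2))%R.
    by field.
  by rewrite E; field.
transitivity ((x + y) / 2 + (expR t * expR (- t)) * ((y - x) / 2))%R.
  by field.
by rewrite E; field.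
Qed.

(** The flow is the linear map with matrix [[al, be], [be, al]],
    where [al + be = 1] and [al - be = expR (- t)], so its determinant is
    [expR (- t)]; it factors into a scaling of the first coordinate with the
    second one fixed, followed by a scaling of the second coordinate. *)
Lemma ge0_integral_flow (t : R) (h : TRR -> \bar R) : measurable_fun setT h ->
  (forall p, 0 <= h p) ->
  \int[lebesgue2]_p h (flow t p) = (expR t)%:E * \int[lebesgue2]_p h p.
Proof.
rewrite /lebesgue2 => mh h0.
pose al := ((1 + expR (- t)) / 2)%R; pose be := ((1 - expR (- t)) / 2)%R.
have e0 := expR_gt0 (- t).
have al0 : (0 < al)%R by rewrite /al divr_gt0// addr_gt0.
pose k (p : TRR) := h (p.1, (be / al * p.1 + expR (- t) / al * p.2)%R).
have mk : measurable_fun setT k.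
  apply: measurableT_comp => //; apply: measurable_fun_pair => //=.
  by apply: measurable_funD => //; apply: measurable_funM.
have flowE (x y : R) : h (flow t (x, y)) = k ((al * x + be * y)%R, y).
  rewrite /k /=; congr (h (_, _)); rewrite /= /al /be; first by field.
  by field; rewrite gt_eqF// addr_gt0.
transitivity (\int[mu]_y \int[mu]_x k ((al * x + be * y)%R, y)).
  pose hf : TRR -> \bar R := fun p => h (flow t p).
  have mhf : measurable_fun [set: TRR] hf.
    by apply: measurableT_comp => //; exact: measurable_flow.
  rewrite -[LHS]/(\int[mu2]_p hf p) (fubini_tonelli2 hf mhf (fun=> h0 _)).
  by apply: eq_integral => y _; apply: eq_integral => x _; exact: flowE.
transitivity (\int[mu]_y ((al^-1)%:E * \int[mu]_x k (x, y))).
  apply: eq_integral => y _.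
  exact: (ge0_integral_affine (be * y) al0 (measurable_fun_pair1 y mk)
    (fun=> h0 _)).
have mkG := measurable_fun_fubini_tonelli_G (m1 := mu) k mk (fun=> h0 _).
have al0' : (0 <= al^-1)%R by rewrite invr_ge0 ltW.
rewrite ge0_integralZl//; last by move=> y _; apply: integral_ge0 => x _; exact: h0.
rewrite -(fubini_tonelli k mk (fun=> h0 _)).
transitivity ((al^-1)%:E * \int[mu]_x ((al * expR t)%:E * \int[mu]_y h (x, y))).
  congr (_ * _); apply: eq_integral => x _ /=; rewrite /k /=.
  under eq_integral do rewrite addrC.
  have d0 : (0 < expR (- t) / al)%R by rewrite divr_gt0.
  rewrite (ge0_integral_affine (be / al * x) d0 (measurable_fun_pair2 x mh))//.
  by rewrite invf_div expRN invrK.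
have mhF := measurable_fun_fubini_tonelli_F (m2 := mu) h mh h0.
rewrite ge0_integralZl//; last 2 first.
- by move=> x _; apply: integral_ge0 => y _; exact: h0.
- by rewrite lee_fin mulr_ge0// ?expR_ge0// ltW.
by rewrite muleA -EFinM mulrA mulVf ?gt_eqF// mul1r -fubini_tonelli1.
Qed.
End ChangeOfVariables.

(** * The equations tested against weights *)

Section WeakFormulation.
Context {R : realType}.
Local Notation mu := (@lebesgue_measure R).
Local Notation TR := (measurableTypeR R).
Local Notation TRR := (measurableTypeR R * measurableTypeR R)%type.
Local Notation mu2 := (@lebesgue2 R).
Local Open Scope ereal_scope.

(** Testing [semigroup gamma t h] against a weight amounts to transporting the
    weight along the contracting flow: the factor [expR t] of the semigroup
    compensates the Jacobian, so only the decay [expR (- (gamma * t))] is left. *)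
Lemma semigroup_dual (gamma t : R) (w h : TRR -> R) :
  measurable_fun setT w -> measurable_fun setT h ->
  (forall p, 0 <= w p)%R -> (forall p, 0 <= h p)%R ->
  \int[mu2]_p (w p * semigroup gamma t h p)%:E =
  (expR (- (gamma * t)))%:E * \int[mu2]_p (w (flow t p) * h p)%:E.
Proof.
move=> mw mh w0 h0.
pose k (p : TRR) := (w (flow t p) * h p)%:E.
have mk : measurable_fun setT k.
  apply/measurable_EFinP; apply: measurable_funM => //.
  by apply: measurableT_comp => //; exact: measurable_flow.
have k0 p : 0 <= k p by rewrite lee_fin mulr_ge0.
have E p : (w p * semigroup gamma t h p)%:E =
    (expR ((1 - gamma) * t))%:E * k (flow (- t) p).
  have := flowK (- t) p; rewrite opprK /k /semigroup => ->.
  by rewrite -EFinM; congr (_%:E); ring.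
under eq_integral do rewrite E.
have mkf : measurable_fun [set: TRR] (k \o flow (- t)).
  by apply: measurableT_comp => //; exact: measurable_flow.
rewrite ge0_integralZl ?lee_fin ?expR_ge0//.
rewrite ge0_integral_flow// muleA -EFinM -expRD.
by congr ((expR _)%:E * _); ring.
Qed.

Variables (lambda gamma : R) (A : TR -> R) (f0 : TR -> R) (g0 : TRR -> R)
  (f : R -> TR -> R) (g : R -> TRR -> R).
Hypotheses (lambda0 : (0 < lambda)%R) (gamma0 : (0 < gamma)%R).
Hypotheses (mA : measurable_fun setT A)
  (mf0 : measurable_fun setT f0) (mg0 : measurable_fun setT g0)
  (mf : measurable_fun setT (fun q : TR * TR => f q.1 q.2))
  (mg : measurable_fun setT (fun q : TR * TRR => g q.1 q.2)).
Hypotheses (f0_ge0 : forall x, (0 <= f0 x)%R) (g0_ge0 : forall p, (0 <= g0 p)%R)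
  (f_ge0 : forall t x, (0 <= f t x)%R) (g_ge0 : forall t p, (0 <= g t p)%R).
Hypothesis fE : forall t : R, (0 <= t)%R -> {ae mu, forall x : TR,
  (f t x)%:E = (expR (- A t) * f0 x)%:E +
    (2 * gamma)%:E * \int[mu]_(s in `[0%R, t])
      ((expR (- (A t - A s)))%:E * \int[mu]_y (g s (x, y))%:E)}.
Hypothesis gE : forall t : R, (0 <= t)%R -> {ae mu2, forall p : TRR,
  (g t p)%:E = (semigroup gamma t g0 p)%:E +
    lambda%:E * \int[mu]_(s in `[0%R, t])
      (semigroup gamma (t - s) (fun q => f s q.1 * f s q.2)%R p)%:E}.

Let mft (t : R) : measurable_fun setT (f t).
Proof. exact: (measurable_fun_pair2 t mf). Qed.

Let mgt (t : R) : measurable_fun setT (g t).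
Proof. exact: (measurable_fun_pair2 t mg). Qed.

Let mgxy : measurable_fun setT (fun q : (TR * TR) * TR => g q.1.1 (q.1.2, q.2)).
Proof.
have m : measurable_fun setT (fun q : (TR * TR) * TR => (q.1.1, (q.1.2, q.2))).
  apply: measurable_fun_pair; first exact: measurableT_comp.
  by apply: measurable_fun_pair => //; exact: measurableT_comp.
exact: (measurableT_comp mg m).
Qed.

Let H (q : TR * TR) := \int[mu]_y (g q.1 (q.2, y))%:E.

Let mH : measurable_fun setT H.
Proof.
have mgE : measurable_fun setT
    (fun q : (TR * TR) * TR => (g q.1.1 (q.1.2, q.2))%:E) by exact/measurable_EFinP.
exact: (measurable_fun_fubini_tonelli_F _ mgE (fun=> g_ge0 _ _)).
Qed.

Let H0 q : 0 <= H q.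
Proof. by apply: integral_ge0 => y _; rewrite lee_fin. Qed.

(** As all terms are nonnegative, the integrals in time and state commute before
    anything is known about their finiteness. *)
Lemma weak_f (w : TR -> R) (t : R) : measurable_fun setT w ->
  (forall x, 0 <= w x)%R -> (0 <= t)%R ->
  \int[mu]_x (w x * f t x)%:E =
    (expR (- A t))%:E * \int[mu]_x (w x * f0 x)%:E +
    (2 * gamma)%:E * \int[mu]_(s in `[0%R, t])
      ((expR (- (A t - A s)))%:E * \int[mu2]_p (w p.1 * g s p)%:E).
Proof.
move=> mw w0 t0.
pose D : set TR := `[0%R, t]%classic.
have mD : measurable D by exact: measurable_itv.
pose k (q : TR * TR) := (expR (- (A t - A q.1)))%:E * H q.
have mk : measurable_fun setT k.
  apply: emeasurable_funM => //; apply/measurable_EFinP.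
  apply: measurable_expR_comp; apply: measurableT_comp => //.
  by apply: measurable_funB => //; exact: measurableT_comp.
have k0 q : 0 <= k q by rewrite mule_ge0// lee_fin expR_ge0.
pose K (q : TR * TR) := (w q.2)%:E * k q.
have mK : measurable_fun setT K.
  apply: emeasurable_funM => //; apply/measurable_EFinP.
  exact: measurableT_comp.
have K0 q : 0 <= K q by rewrite mule_ge0// lee_fin.
have mKD := measurable_fun_integral_on mu mD mK K0.
have g2 : (0 <= 2 * gamma)%R by rewrite mulr_ge0// ltW.
transitivity (\int[mu]_x ((expR (- A t))%:E * (w x * f0 x)%:E +
    (2 * gamma)%:E * \int[mu]_(s in D) K (s, x))).
  apply: ge0_ae_eq_integral => //.
  - by apply/measurable_EFinP; exact: measurable_funM.
  - apply: emeasurable_funD; apply: emeasurable_funM => //.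
    by apply/measurable_EFinP; exact: measurable_funM.
  - by move=> x _; rewrite lee_fin mulr_ge0.
  - move=> x _; apply: adde_ge0; apply: mule_ge0; rewrite ?lee_fin ?expR_ge0//.
      by rewrite mulr_ge0.
    exact: integral_ge0.
  - have := fE t0; apply: filterS => x fx _.
    rewrite EFinM fx ge0_muleDr; last 2 first.
    + by rewrite lee_fin mulr_ge0// expR_ge0.
    + rewrite mule_ge0// integral_ge0// => s _.
      by rewrite mule_ge0// ?lee_fin ?expR_ge0// (H0 (s, x)).
    congr (_ + _); first by rewrite -!EFinM; congr (_%:E); ring.
    rewrite muleCA; congr (_ * _); rewrite -ge0_integralZl ?lee_fin//.
      apply: measurable_funTS; exact: (measurable_fun_pair1 x mk).
    by move=> s _; exact: (k0 (s, x)).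
rewrite ge0_integralD//; last 4 first.
- by move=> x _; rewrite -EFinM lee_fin mulr_ge0// ?expR_ge0// mulr_ge0.
- apply: emeasurable_funM => //; apply/measurable_EFinP; exact: measurable_funM.
- by move=> x _; rewrite mule_ge0 ?lee_fin// integral_ge0.
- exact: emeasurable_funM.
congr (_ + _).
  rewrite ge0_integralZl ?lee_fin ?expR_ge0//.
    by apply/measurable_EFinP; exact: measurable_funM.
  by move=> x _; rewrite lee_fin mulr_ge0.
rewrite ge0_integralZl ?lee_fin//; last by move=> x _; exact: integral_ge0.
congr (_ * _).
rewrite (tonelli_on mu mu mD mK K0); apply: eq_integral => s _.
have mwg : measurable_fun setT (fun p : TRR => (w p.1 * g s p)%:E).
  apply/measurable_EFinP; apply: measurable_funM => //; exact: measurableT_comp.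
have wg0 (p : TRR) : 0 <= (w p.1 * g s p)%:E by rewrite lee_fin mulr_ge0.
rewrite /lebesgue2 (fubini_tonelli1 _ mwg wg0) -ge0_integralZl//; last 2 first.
- exact: (measurable_fun_fubini_tonelli_F _ mwg wg0).
- by move=> x _; apply: integral_ge0 => y _; exact: wg0.
apply: eq_integral => x _; rewrite /K /k /= muleCA; congr (_ * _).
rewrite /H /= -ge0_integralZl ?lee_fin//.
  by apply/measurable_EFinP; exact: (measurable_fun_pair2 x (mgt s)).
by move=> y _; rewrite lee_fin.
Qed.

Lemma weak_g (w : TRR -> R) (t : R) : measurable_fun setT w ->
  (forall p, 0 <= w p)%R -> (0 <= t)%R ->
  \int[mu2]_p (w p * g t p)%:E =
    (expR (- (gamma * t)))%:E * \int[mu2]_p (w (flow t p) * g0 p)%:E +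
    lambda%:E * \int[mu]_(s in `[0%R, t])
      ((expR (- (gamma * (t - s))))%:E *
       \int[mu2]_p (w (flow (t - s) p) * (f s p.1 * f s p.2))%:E).
Proof.
move=> mw w0 t0; have l0 := ltW lambda0.
pose D : set TR := `[0%R, t]%classic.
have mD : measurable D by exact: measurable_itv.
pose k (q : TR * TRR) :=
  (semigroup gamma (t - q.1) (fun p => f q.1 p.1 * f q.1 p.2)%R q.2)%:E.
have mk : measurable_fun setT k.
  apply/measurable_EFinP; apply: measurable_funM.
    apply: measurable_expR_comp; apply: measurable_funM => //.
    exact: measurable_funB.
  have mF : measurable_fun setT (fun q : TR * TRR => flow (- (t - q.1)) q.2).
    apply: measurable_flow_comp => //; apply: measurableT_comp => //.
    exact: measurable_funB.
  apply: measurable_funM.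
    have m : measurable_fun setT
        (fun q : TR * TRR => (q.1, (flow (- (t - q.1)) q.2).1)).
      by apply: measurable_fun_pair => //; exact: measurableT_comp.
    exact: (measurableT_comp mf m).
  have m : measurable_fun setT
      (fun q : TR * TRR => (q.1, (flow (- (t - q.1)) q.2).2)).
    by apply: measurable_fun_pair => //; exact: measurableT_comp.
  exact: (measurableT_comp mf m).
have k0 q : 0 <= k q by rewrite lee_fin mulr_ge0// ?expR_ge0// mulr_ge0.
pose K (q : TR * TRR) := (w q.2)%:E * k q.
have mK : measurable_fun setT K.
  apply: emeasurable_funM => //; apply/measurable_EFinP.
  exact: measurableT_comp.
have K0 q : 0 <= K q by rewrite mule_ge0// lee_fin.
have mKD := measurable_fun_integral_on mu mD mK K0.
have sg0 p : (0 <= semigroup gamma t g0 p)%R by rewrite mulr_ge0// expR_ge0.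
have msg : measurable_fun setT (semigroup gamma t g0 : TRR -> R).
  apply: measurable_funM => //; apply: measurableT_comp => //.
  exact: measurable_flow.
have mwsg : measurable_fun setT (fun p : TRR => (w p * semigroup gamma t g0 p)%:E).
  by apply/measurable_EFinP; exact: measurable_funM.
transitivity (\int[mu2]_p ((w p * semigroup gamma t g0 p)%:E +
    lambda%:E * \int[mu]_(s in D) K (s, p))).
  apply: ge0_ae_eq_integral => //.
  - by apply/measurable_EFinP; exact: measurable_funM.
  - by apply: emeasurable_funD => //; exact: emeasurable_funM.
  - by move=> x _; rewrite lee_fin mulr_ge0.
  - move=> x _; apply: adde_ge0; first by rewrite lee_fin mulr_ge0.
    by rewrite mule_ge0 ?lee_fin// integral_ge0.
  - have := gE t0; apply: filterS => p gp _.
    rewrite EFinM gp ge0_muleDr ?lee_fin//; last first.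
      rewrite mule_ge0 ?lee_fin// integral_ge0// => s _.
      exact: (k0 (s, p)).
    congr (_ + _).
    rewrite muleCA; congr (_ * _); rewrite -ge0_integralZl ?lee_fin//.
      apply: measurable_funTS; exact: (measurable_fun_pair1 p mk).
    by move=> s _; exact: (k0 (s, p)).
rewrite ge0_integralD//; last 3 first.
- by move=> p _; rewrite lee_fin mulr_ge0.
- by move=> p _; rewrite mule_ge0 ?lee_fin// integral_ge0.
- exact: emeasurable_funM.
congr (_ + _); first by rewrite semigroup_dual.
rewrite ge0_integralZl ?lee_fin//; last first.
  by move=> p _; exact: integral_ge0.
congr (_ * _).
rewrite (tonelli_on mu mu2 mD mK K0); apply: eq_integral => s _.
rewrite -semigroup_dual//.
  by apply: measurable_funM; apply: measurableT_comp.
by move=> p; rewrite mulr_ge0.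
Qed.
End WeakFormulation.

(** * Representatives defined everywhere *)

Section Representatives.
Context {R : realType}.
Local Notation mu := (@lebesgue_measure R).
Local Notation TR := (measurableTypeR R).
Local Notation TRR := (measurableTypeR R * measurableTypeR R)%type.
Local Notation mu2 := (@lebesgue2 R).

Section Extension.
Context d (T : measurableType d).
Implicit Type h : R -> T -> R.

Definition zero_ext h : R -> T -> R :=
  fun t x => ((fun q : TR * T => h q.1 q.2) \_ (`[0, +oo[ `*` setT)) (t, x).

(** The values of [h] at negative times and its sign on null sets are arbitrary.
    Fixing both keeps the class of [h t] for [0 <= t] and the joint
    measurability, and makes nonnegativity a pointwise property. *)
Definition pos_rep h : R -> T -> R := fun t x => Num.max (zero_ext h t x) 0.

Lemma zero_extE h t x : 0 <= t -> zero_ext h t x = h t x.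
Proof.
move=> t0; rewrite /zero_ext patchE in_setX in_setT andbT mem_set//=.
by rewrite in_itv/= t0.
Qed.

Lemma zero_ext_lt0 h t x : t < 0 -> zero_ext h t x = 0.
Proof.
move=> t0; rewrite /zero_ext patchE in_setX in_setT andbT memNset//=.
by rewrite in_itv/= andbT; apply/negP; rewrite -ltNge.
Qed.

Lemma pos_rep_ge0 h t x : 0 <= pos_rep h t x.
Proof. by rewrite le_max lexx orbT. Qed.

Section Measurability.
Variable h : R -> T -> R.
Hypothesis mh : measurable_fun ((`[0, +oo[ : set TR) `*` setT)
  (fun q : TR * T => h q.1 q.2).

Lemma measurable_zero_ext :
  measurable_fun setT (fun q : TR * T => zero_ext h q.1 q.2).
Proof.
have mD : measurable ((`[0, +oo[%classic : set TR) `*` [set: T]).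
  by apply: measurableX => //; exact: measurable_itv.
have := (measurable_restrictT _ mD).1 mh.
by apply: eq_measurable_fun => -[t x] _.
Qed.

Lemma measurable_pos_rep :
  measurable_fun setT (fun q : TR * T => pos_rep h q.1 q.2).
Proof. by apply: measurable_maxr => //; exact: measurable_zero_ext. Qed.
End Measurability.

Lemma ae_pos_rep (m : {measure set T -> \bar R}) h (t : R) :
  continuous_L1_plus m h -> {ae m, forall x, zero_ext h t x = pos_rep h t x}.
Proof.
move=> [_ h0 _]; have [t0|t0] := leP 0 t.
  have := h0 t t0; apply: filterS => x hx.
  by rewrite /pos_rep zero_extE//; apply/esym/max_idPl.
by apply: aeW => x; rewrite /pos_rep zero_ext_lt0// maxxx.
Qed.

Lemma ae_eq_pos_rep (m : {measure set T -> \bar R}) h (t : R) : 0 <= t ->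
  continuous_L1_plus m h -> {ae m, forall x, h t x = pos_rep h t x}.
Proof.
by move=> t0 /(@ae_pos_rep _ _ t); apply: filterS => x; rewrite zero_extE.
Qed.
End Extension.

Definition cumulated_rate (lambda : R) (Mf : R -> R) (t : R) : R :=
  2 * lambda * \int[mu]_(r in `[0, t]) Mf r.

Section Rate.
Variables (lambda : R) (Mf : R -> R).
Hypothesis cMf : {within `[0, +oo[, continuous Mf}.

Lemma cumulated_rate_le0 (t : R) : t <= 0 -> cumulated_rate lambda Mf t = 0.
Proof.
rewrite /cumulated_rate le_eqVlt => /predU1P[->|t0].
  by rewrite set_itv1 Rintegral_set1 mulr0.
by rewrite set_itv_ge ?bnd_simp -?ltNge// Rintegral_set0 mulr0.
Qed.

Lemma cumulated_rate_continuous :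
  {within `[0, +oo[, continuous (cumulated_rate lambda Mf)}.
Proof.
apply: cont0M; first exact: cont0_cst.
by apply: primitive_continuous => T; exact: continuous0_integrable.
Qed.

Lemma cumulated_rate_derive (t : R) : 0 < t ->
  is_derive t 1 (cumulated_rate lambda Mf) (2 * lambda * Mf t).
Proof. by move=> t0; have := is_deriveZ (2 * lambda) (primitive_derive cMf t0). Qed.

Lemma measurable_cumulated_rate :
  measurable_fun [set: TR] (cumulated_rate lambda Mf).
Proof.
have mD : measurable (`[0, +oo[%classic : set TR) by exact: measurable_itv.
have := (measurable_restrictT _ mD).1 (cont0_measurable cumulated_rate_continuous).
apply: eq_measurable_fun => t _ /=; rewrite patchE; case: ifPn => // tD.
rewrite cumulated_rate_le0//; move: tD; rewrite notin_setE/= in_itv/= andbT.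
by move/negP; rewrite -ltNge => /ltW.
Qed.

Lemma decayE (s t : R) : 0 <= s -> s <= t -> decay lambda Mf s t =
  expR (- (cumulated_rate lambda Mf t - cumulated_rate lambda Mf s)).
Proof.
move=> s0 st; rewrite /decay /cumulated_rate -mulrBr.
have iM := continuous0_integrable t cMf.
have := @Rintegral_itvB R Mf (BLeft 0) (BRight t) s iM.
rewrite !bnd_simp => /(_ s0 st) ->.
rewrite Rintegral_itv_obnd_cbnd//.
apply: integrableS iM => //.
by apply: subset_itvScc; rewrite bnd_simp.
Qed.
End Rate.

Local Open Scope ereal_scope.

(** The Jacobian of the flow is constant, so preimages of null sets are null. *)
Lemma ae_flow (P : TRR -> Prop) (t : R) : {ae mu2, forall p, P p} ->
  {ae mu2, forall p, P (flow t p)}.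
Proof.
move=> [N [mN N0 PN]]; exists (flow t @^-1` N); split.
- by rewrite -[X in measurable X]setTI; exact: measurable_flow.
- have mI : measurable_fun setT (EFin \o \1_N : TRR -> \bar R).
    by apply/measurable_EFinP; exact: measurable_indic.
  have mFN : measurable (flow t @^-1` N : set TRR).
    by rewrite -[X in measurable X]setTI; exact: measurable_flow.
  have I0 p : 0 <= (EFin \o \1_N : TRR -> \bar R) p by rewrite lee_fin.
  have := ge0_integral_flow t mI I0.
  have -> : \int[mu2]_p (EFin \o \1_N) p = 0.
    by rewrite -[RHS]N0 (integral_indic mu2 measurableT mN) setIT.
  rewrite mule0 => <-.
  by rewrite -[X in mu2 X]setIT -(integral_indic mu2 measurableT mFN).
- by move=> p /= Pp; apply: PN.
Qed.

Lemma ae_fst (P : TR -> Prop) : {ae mu, forall x, P x} ->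
  {ae mu2, forall p, P p.1}.
Proof.
move=> [N [mN N0 PN]]; exists (N `*` setT); split.
- exact: measurableX.
- transitivity (mu N * mu [set: TR]); last by rewrite N0 mul0e.
  exact: product_measure1E.
- by move=> p /= Pp; split => //; exact: PN.
Qed.

Lemma ae_snd (P : TR -> Prop) : {ae mu, forall x, P x} ->
  {ae mu2, forall p, P p.2}.
Proof.
move=> [N [mN N0 PN]]; exists (setT `*` N); split.
- exact: measurableX.
- transitivity (mu [set: TR] * mu N); last by rewrite N0 mule0.
  exact: product_measure1E.
- by move=> p /= Pp; split => //; exact: PN.
Qed.

(** Tonelli's theorem covers the positive and the negative part; the signed case
    occurs because [zero_ext g] may be negative on a null set. *)
Lemma measurable_fun_fubini_F (h : TRR * TR -> R) : measurable_fun setT h ->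
  measurable_fun setT (fun q : TRR => \int[mu]_y (h (q, y))%:E).
Proof.
move=> mh; under eq_fun do rewrite integralE.
have mhE : measurable_fun setT (EFin \o h) by exact/measurable_EFinP.
apply: emeasurable_funB.
  have := measurable_fun_fubini_tonelli_F (m2 := mu) _ (measurable_funepos mhE)
    (funepos_ge0 _).
  apply: eq_measurable_fun => q _; apply: eq_integral => y _.
  by rewrite !funeposE.
have := measurable_fun_fubini_tonelli_F (m2 := mu) _ (measurable_funeneg mhE)
  (funeneg_ge0 _).
apply: eq_measurable_fun => q _; apply: eq_integral => y _.
by rewrite !funenegE.
Qed.

Section Equations.
Variables (lambda gamma : R) (f0 : TR -> R) (g0 : TRR -> R)
  (f : R -> TR -> R) (g : R -> TRR -> R) (Mf : R -> R).
Hypotheses (cf : continuous_L1_plus mu f) (cg : continuous_L1_plus mu2 g).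
Hypotheses (mf : measurable_fun ((`[0%R, +oo[ : set TR) `*` setT)
    (fun q : TR * TR => f q.1 q.2))
  (mg : measurable_fun ((`[0%R, +oo[ : set TR) `*` setT)
    (fun q : TR * TRR => g q.1 q.2)).
Hypothesis cMf : {within `[0%R, +oo[, continuous Mf}.
Hypothesis fE : forall t : R, (0 <= t)%R -> {ae mu, forall x : TR,
  (f t x)%:E = (decay lambda Mf 0 t * f0 x)%:E +
    (2 * gamma)%:E * \int[mu]_(s in `[0%R, t])
      ((decay lambda Mf s t)%:E * \int[mu]_y (g s (x, y))%:E)}.
Hypothesis gE : forall t : R, (0 <= t)%R -> {ae mu2, forall p : TRR,
  (g t p)%:E = (semigroup gamma t g0 p)%:E +
    lambda%:E * \int[mu]_(s in `[0%R, t])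
      (semigroup gamma (t - s) (fun q => f s q.1 * f s q.2)%R p)%:E}.

Let A := cumulated_rate lambda Mf.

(** At each time the two representatives of [g] have, for almost every first
    coordinate, the same integral over the second one. By [ae_ysection], for
    almost every first coordinate these integrals agree at almost all times,
    which is what the integral in time requires. The exceptional set is
    measurable, being described by the jointly measurable [H1] and [H2]. *)
Lemma pos_rep_fE (t : R) : (0 <= t)%R -> {ae mu, forall x : TR,
  (pos_rep f t x)%:E = (expR (- A t) * f0 x)%:E +
    (2 * gamma)%:E * \int[mu]_(s in `[0%R, t])
      ((expR (- (A t - A s)))%:E * \int[mu]_y (pos_rep g s (x, y))%:E)}.
Proof.
move=> t0.
have decay0 : decay lambda Mf 0 t = expR (- A t).
  rewrite (decayE lambda cMf (lexx 0%R) t0).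
  by rewrite (cumulated_rate_le0 lambda Mf (lexx 0%R)) subr0.
have mswap : measurable_fun setT
    (fun q : (TR * TR) * TR => (q.1.1, (q.1.2, q.2))).
  apply: measurable_fun_pair; first exact: measurableT_comp.
  by apply: measurable_fun_pair => //; exact: measurableT_comp.
pose H1 (q : TRR) := \int[mu]_y (zero_ext g q.1 (q.2, y))%:E.
pose H2 (q : TRR) := \int[mu]_y (pos_rep g q.1 (q.2, y))%:E.
have mH1 : measurable_fun setT H1.
  exact: (measurable_fun_fubini_F (measurableT_comp (measurable_zero_ext mg) mswap)).
have mH2 : measurable_fun setT H2.
  exact: (measurable_fun_fubini_F (measurableT_comp (measurable_pos_rep mg) mswap)).
have mH : measurable [set q | H1 q = H2 q].
  by rewrite -[X in measurable X]setTI; exact: measurable_eqe.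
have H12 (s : R) : {ae mu, forall x, H1 (s, x) = H2 (s, x)}.
  have := ae_xsection (ae_pos_rep s cg).
  apply: filterS => x gx; apply: ae_eq_integral => //.
  - apply/measurable_EFinP.
    exact: (measurable_fun_pair2 x (measurable_fun_pair2 s (measurable_zero_ext mg))).
  - apply/measurable_EFinP.
    exact: (measurable_fun_pair2 x (measurable_fun_pair2 s (measurable_pos_rep mg))).
  - by apply: filterS gx => y + _ => ->.
have := ae_ysection mu mH H12.
apply: filterS3 (fE t0) (ae_eq_pos_rep t0 cf) => x fx fpx Hx.
rewrite -fpx fx decay0.
suff E : \int[mu]_(s in `[0%R, t])
      ((decay lambda Mf s t)%:E * \int[mu]_y (g s (x, y))%:E) =
    \int[mu]_(s in `[0%R, t])
      ((expR (- (A t - A s)))%:E * \int[mu]_y (pos_rep g s (x, y))%:E).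
  by rewrite E; reflexivity.
have mA := measurable_cumulated_rate lambda cMf.
transitivity (\int[mu]_(s in `[0%R, t]) ((expR (- (A t - A s)))%:E * H1 (s, x))).
  apply: eq_integral => s; rewrite inE/= in_itv/= => /andP[s0 st].
  rewrite decayE//; congr (_ * _); apply: eq_integral => y _.
  by rewrite zero_extE.
have mE : measurable_fun [set: TR] (fun s => (expR (- (A t - A s)))%:E).
  apply/measurable_EFinP; apply: measurable_expR_comp.
  by apply: measurableT_comp => //; exact: measurable_funB.
apply: ae_eq_integral => //.
- apply: measurable_funTS; apply: emeasurable_funM => //.
  exact: (measurable_fun_pair1 x mH1).
- apply: measurable_funTS; apply: emeasurable_funM => //.
  exact: (measurable_fun_pair1 x mH2).
- by apply: filterS Hx => s /= + _ => ->.
Qed.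

Lemma pos_rep_gE (t : R) : (0 <= t)%R -> {ae mu2, forall p : TRR,
  (pos_rep g t p)%:E = (semigroup gamma t g0 p)%:E +
    lambda%:E * \int[mu]_(s in `[0%R, t])
      (semigroup gamma (t - s)
         (fun q => pos_rep f s q.1 * pos_rep f s q.2)%R p)%:E}.
Proof.
move=> t0.
have mexp : measurable_fun setT
    (fun q : TR * TRR => expR ((1 - gamma) * (t - q.1))).
  by apply: measurable_expR_comp; apply: measurable_funM => //; exact: measurable_funB.
have mF : measurable_fun setT (fun q : TR * TRR => flow (- (t - q.1)) q.2).
  apply: measurable_flow_comp => //; apply: measurableT_comp => //.
  exact: measurable_funB.
have mFl1 : measurable_fun setT
    (fun q : TR * TRR => (q.1, (flow (- (t - q.1)) q.2).1)).
  apply: measurable_fun_pair => //; exact: measurableT_comp.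
have mFl2 : measurable_fun setT
    (fun q : TR * TRR => (q.1, (flow (- (t - q.1)) q.2).2)).
  apply: measurable_fun_pair => //; exact: measurableT_comp.
pose K (h : R -> TR -> R) (q : TR * TRR) :=
  (semigroup gamma (t - q.1) (fun p => h q.1 p.1 * h q.1 p.2)%R q.2)%:E.
have mK h : measurable_fun setT (fun q : TR * TR => h q.1 q.2) ->
    measurable_fun setT (K h).
  move=> mh; apply/measurable_EFinP; apply: measurable_funM => //.
  apply: measurable_funM.
    exact: (measurableT_comp mh mFl1).
  exact: (measurableT_comp mh mFl2).
have mK1 := mK _ (measurable_zero_ext mf).
have mK2 := mK _ (measurable_pos_rep mf).
have mKE : measurable [set q | K (zero_ext f) q = K (pos_rep f) q].
  by rewrite -[X in measurable X]setTI; exact: measurable_eqe.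
have K12 (s : R) : {ae mu2, forall p, K (zero_ext f) (s, p) = K (pos_rep f) (s, p)}.
  have fs := ae_pos_rep s cf.
  have F1 := ae_flow (- (t - s)) (ae_fst fs).
  have F2 := ae_flow (- (t - s)) (ae_snd fs).
  have FF : Filter (almost_everywhere mu2) by exact: ae_filter_ringOfSetsType.
  apply: filterS2 F1 F2 => p e1 e2.
  by rewrite /K /semigroup /= e1 e2.
have := ae_ysection mu mKE K12.
apply: filterS3 (gE t0) (ae_eq_pos_rep t0 cg) => p gp gpp Kp.
rewrite -gpp gp; congr (_ + _ * _).
transitivity (\int[mu]_(s in `[0%R, t]) K (zero_ext f) (s, p)).
  apply: eq_integral => s; rewrite inE/= in_itv/= => /andP[s0 st].
  by rewrite /K /semigroup /= !zero_extE.
apply: ae_eq_integral => //.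
- by apply: measurable_funTS; exact: (measurable_fun_pair1 p mK1).
- by apply: measurable_funTS; exact: (measurable_fun_pair1 p mK2).
- by apply: filterS Kp => s /= + _ => ->.
Qed.
End Equations.
End Representatives.

(** * Integrable functions and bounded weights *)

Section RealIntegrals.
Context d (T : measurableType d) (R : realType) (m : {measure set T -> \bar R}).
Implicit Types u v w : T -> R.
Local Notation intble u := (m.-integrable setT (EFin \o u)).

Lemma EFin_Rintegral u : intble u ->
  (\int[m]_x (u x)%:E)%E = (\int[m]_x u x)%:E.
Proof.
by move=> iu; rewrite /Rintegral fineK//; exact: integrable_fin_num iu.
Qed.

Lemma intble_measurable u : intble u -> measurable_fun setT u.
Proof. by move=> /(measurable_int m)/measurable_EFinP. Qed.

Lemma dominated_intble u v : measurable_fun setT u -> intble v ->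
  (forall x, `|u x| <= v x) -> intble u.
Proof.
move=> mu_ iv uv; apply: le_integrable iv => //.
  exact/measurable_EFinP.
by move=> x _ /=; rewrite lee_fin (le_trans (uv x))// ler_norm.
Qed.

Lemma ge0_intble u : measurable_fun setT u -> (forall x, 0 <= u x) ->
  (\int[m]_x (u x)%:E < +oo)%E -> intble u.
Proof.
move=> mu_ u0 uoo; apply/integrableP; split; first exact/measurable_EFinP.
by under eq_integral do rewrite /= ger0_norm//.
Qed.

Lemma intbleD u v : intble u -> intble v -> intble (fun x => u x + v x).
Proof. by move=> iu iv; have := integrableD measurableT iu iv. Qed.

Lemma intbleB u v : intble u -> intble v -> intble (fun x => u x - v x).
Proof. by move=> iu iv; have := integrableB measurableT iu iv. Qed.

Lemma intbleZ (k : R) u : intble u -> intble (fun x => k * u x).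
Proof. by move=> iu; have := integrableZl measurableT k iu. Qed.

Lemma bounded_intble w u (C : R) : measurable_fun setT w ->
  (forall x, `|w x| <= C) -> intble u -> intble (fun x => w x * u x).
Proof.
move=> mw wC iu; have miu := intble_measurable iu.
have iCu : intble (fun x => C * `|u x|) by apply: intbleZ; exact: integrable_norm.
apply: dominated_intble iCu _; first exact: measurable_funM.
by move=> x; rewrite normrM ler_wpM2r.
Qed.

Lemma ae_eq_Rintegral u v : measurable_fun setT u -> measurable_fun setT v ->
  {ae m, forall x, u x = v x} -> \int[m]_x u x = \int[m]_x v x.
Proof.
move=> mu_ mv uv; rewrite /Rintegral; congr fine; apply: ae_eq_integral => //.
- exact/measurable_EFinP.
- exact/measurable_EFinP.
- by apply: filterS uv => x -> _.
Qed.

Lemma truncation_limit u v (c : \bar R) :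
  measurable_fun setT u -> measurable_fun setT v ->
  (forall x, 0 <= u x) -> (forall x, 0 <= v x) ->
  (forall n : nat, (\int[m]_x (Num.min (u x) n%:R * v x)%:E <= c)%E) ->
  (\int[m]_x (u x * v x)%:E <= c)%E.
Proof.
move=> mu_ mv u0 v0 uvc.
pose h n x := (Num.min (u x) n%:R * v x)%:E.
have mh n : measurable_fun setT (h n).
  by apply/measurable_EFinP; apply: measurable_funM => //; exact: measurable_minr.
have h0 n x : setT x -> (0 <= h n x)%E.
  by move=> _; rewrite lee_fin mulr_ge0// le_min u0 ler0n.
have nd x : setT x -> nondecreasing_seq (h^~ x).
  move=> _ k n kn; rewrite lee_fin ler_wpM2r// le_min ge_min lexx/=.
  by rewrite ge_min ler_nat kn orbT.
have hE x : limn (h^~ x) = (u x * v x)%:E.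
  apply: cvg_lim => //; apply: cvg_near_cst.
  exists (Num.truncn (u x)).+1 => // n /= un.
  rewrite /h; congr ((_ * _)%:E); apply/min_idPl.
  by rewrite ltW// (lt_le_trans (truncnS_gt _))// ler_nat.
have hcvg := @cvg_monotone_convergence _ _ _ m _ measurableT _ mh h0 nd.
have <- : (\int[m]_x limn (h^~ x) = \int[m]_x (u x * v x)%:E)%E.
  by apply: eq_integral => x _; exact: hE.
rewrite -(cvg_lim _ hcvg)//; apply: lime_le.
  by apply/cvg_ex; eexists; exact: hcvg.
by apply: nearW => n; exact: uvc.
Qed.

Lemma bounded_moment_continuous (h : R -> T -> R) w (C : R) :
  continuous_L1_plus m h -> measurable_fun setT w -> (forall x, `|w x| <= C) ->
  {within `[0, +oo[, continuous (fun t => \int[m]_x (w x * h t x))}.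
Proof.
move=> [h1 _ hc] mw wC.
have ih t : 0 <= t -> intble (h t) by move=> /h1/Lfun1_integrable.
apply/subspace_continuousP => t0; rewrite /= in_itv/= andbT => t00.
have C0 : 0 < C + 1.
  by rewrite ltr_pwDr//; apply: (le_trans (normr_ge0 _) (wC point)).
apply/cvgrPdist_lt => /= e e0.
have /fine_cvgP[fin /cvgr0Pnorm_lt cvg0] := hc t0 t00.
have e1 : 0 < e / (C + 1) by rewrite divr_gt0.
have near0 := cvg0 _ e1.
near=> t.
have t_ge0 : 0 <= t.
  by near: t; rewrite near_withinE; apply: nearW => x; rewrite /= in_itv/= andbT.
have idif : intble (fun x => h t x - h t0 x) by apply: intbleB; exact: ih.
rewrite distrC -RintegralB//; [|by apply: bounded_intble mw wC _; exact: ih..].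
have -> : \int[m]_x (w x * h t x - w x * h t0 x) =
    \int[m]_x (w x * (h t x - h t0 x)).
  by apply: eq_Rintegral => x _; rewrite mulrBr.
apply: (le_lt_trans (le_normr_Rintegral _ _)) => //.
  exact: bounded_intble mw wC idif.
apply: (@le_lt_trans _ _ (\int[m]_x ((C + 1) * `|h t x - h t0 x|))).
  apply: le_Rintegral => //.
  - by apply: integrable_norm; exact: bounded_intble mw wC idif.
  - by apply: intbleZ; exact: integrable_norm.
  - move=> x _; rewrite normrM ler_wpM2r// (le_trans (wC x))//.
    by rewrite lerDl.
rewrite RintegralZl//; last exact: integrable_norm.
rewrite mulrC -ltr_pdivlMr//.
have -> : \int[m]_x `|h t x - h t0 x| =
    `|(fine \o (fun t => 'N[m]_1 [EFin \o (h t \- h t0)%R]%E)) t|.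
  rewrite /= Lnorm1 /Rintegral ger0_norm//.
  by apply: fine_ge0; apply: integral_ge0 => x _; exact: abse_ge0.
by near: t.
Unshelve. all: by end_near. Qed.
End RealIntegrals.

Lemma bounded_integrable_segment (R : realType) (b : R -> R) (T B : R) :
  measurable_fun [set: measurableTypeR R] b ->
  (forall s, 0 <= s <= T -> `|b s| <= B) ->
  (@lebesgue_measure R).-integrable `[0, T] (EFin \o b).
Proof.
move=> mb bB; apply: measurable_bounded_integrable => //.
- by rewrite /= lebesgue_measure_itv/=; case: ifP => _; rewrite -?EFinB ltry.
- exact: measurable_funTS.
exists B; split; first exact: num_real.
move=> x Bx s /=; rewrite in_itv/= => sT.
by rewrite (le_trans (bB _ sT))// ltW.
Qed.

Section ProductIntegrals.
Context {R : realType}.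
Local Notation mu := (@lebesgue_measure R).
Local Notation TR := (measurableTypeR R).
Local Notation TRR := (measurableTypeR R * measurableTypeR R)%type.
Local Notation mu2 := (@lebesgue2 R).

Lemma integrable_tensor (u v : TR -> R) :
  mu.-integrable setT (EFin \o u) -> mu.-integrable setT (EFin \o v) ->
  mu2.-integrable setT (EFin \o (fun p : TRR => u p.1 * v p.2)) /\
  \int[mu2]_p (u p.1 * v p.2) = (\int[mu]_x u x) * \int[mu]_x v x.
Proof.
move=> iu iv.
have mu_ := intble_measurable iu; have mv := intble_measurable iv.
have mUV : measurable_fun setT (fun p : TRR => (u p.1 * v p.2)%:E).
  by apply/measurable_EFinP; apply: measurable_funM; exact: measurableT_comp.
have iUV : mu2.-integrable setT (EFin \o (fun p : TRR => u p.1 * v p.2)).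
  apply/(@integrable12ltyP _ _ _ _ _ mu mu) => //=.
  under eq_integral => x _.
    under eq_integral do rewrite normrM EFinM.
    rewrite ge0_integralZl//; last first.
      by apply/measurable_EFinP; exact: measurableT_comp.
    rewrite (EFin_Rintegral (integrable_norm iv)).
    over.
  rewrite ge0_integralZr//.
  - by rewrite (EFin_Rintegral (integrable_norm iu)) -EFinM ltry.
  - by apply/measurable_EFinP; exact: measurableT_comp.
  - by rewrite lee_fin; apply: Rintegral_ge0 => x _ /=.
split => //.
apply: EFin_inj; rewrite -EFin_Rintegral//.
rewrite /lebesgue2 -(@integral12_prod_meas1 _ _ _ _ _ mu mu _ iUV) /fubini_F/=.
under eq_integral => x _.
  under eq_integral do rewrite EFinM.
  rewrite integralZl// (EFin_Rintegral iv).
  over.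
by rewrite /= integralZr// (EFin_Rintegral iu) EFinM.
Qed.
End ProductIntegrals.

(** * Concentrating families of densities *)

Section ConcentratingFamily.
Context d (T : measurableType d) (R : realType) (m : {measure set T -> \bar R}).

(** In absolute value, the integral of [h t * (psi - l)] is at most [e] times the
    mass plus [C] times the [q]-moment, and for fixed [e] the latter tends to 0:
    mass that gathers where [q] is small sees only the value [l]. *)
Lemma concentration_cvg (h : R -> T -> R) (q psi : T -> R) (l N B : R) :
  (forall t x, 0 <= h t x) ->
  (forall t : R, 0 <= t -> m.-integrable setT (EFin \o h t)) ->
  (forall t : R, 0 <= t -> m.-integrable setT (EFin \o (fun x => q x * h t x))) ->
  measurable_fun setT psi -> (forall x, `|psi x| <= B) ->
  (forall e : R, 0 < e ->
     exists2 C : R, 0 <= C & forall x, `|psi x - l| <= e + C * q x) ->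
  \int[m]_x h t x @[t --> +oo] --> N ->
  \int[m]_x (q x * h t x) @[t --> +oo] --> 0 ->
  \int[m]_x (h t x * psi x) @[t --> +oo] --> N * l.
Proof.
move=> h0 ih iq mpsi psiB psiq hN q0.
have ipsi (t : R) : 0 <= t -> m.-integrable setT (EFin \o (fun x => psi x * h t x)).
  by move=> t0; exact: (bounded_intble mpsi psiB (ih t t0)).
have idif (t : R) : 0 <= t ->
    m.-integrable setT (EFin \o (fun x => (psi x - l) * h t x)).
  move=> t0; apply: eq_integrable (intbleB (ipsi t t0) (intbleZ l (ih t t0))) => //.
  by move=> x _ /=; rewrite mulrBl.
have dif0 : \int[m]_x ((psi x - l) * h t x) @[t --> +oo] --> 0.
  apply/cvgr0Pnorm_le => e e0.
  have N1 : 0 < `|N| + 1 by rewrite ltr_wpDl.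
  pose e' := e / 2 / (`|N| + 1).
  have e'0 : 0 < e' by rewrite !divr_gt0.
  have [C C0 Cq] := psiq _ e'0.
  have nearN := cvgr_le _ hN (`|N| + 1).
  have nearq : \forall t \near +oo, C * \int[m]_x (q x * h t x) <= e / 2.
    have : C * \int[m]_x (q x * h t x) @[t --> +oo] --> C * 0.
      by apply: cvgM => //; exact: cvg_cst.
    by rewrite mulr0 => /cvgr_le; apply; rewrite divr_gt0.
  have {}nearN : \forall t \near +oo, \int[m]_x h t x <= `|N| + 1.
    by apply: nearN; rewrite (le_lt_trans (ler_norm N))// ltrDl.
  near=> t.
  have t0 : 0 <= t by near: t; apply: nbhs_pinfty_ge; rewrite num_real.
  apply: (le_trans (le_normr_Rintegral _ _)) => //; first exact: idif.
  apply: (@le_trans _ _ (\int[m]_x (e' * h t x + C * (q x * h t x)))).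
    apply: le_Rintegral => //; first by apply: integrable_norm; exact: idif.
      by apply: intbleD; apply: intbleZ; [exact: ih|exact: iq].
    move=> x _; rewrite normrM (ger0_norm (h0 t x)) mulrA -mulrDl.
    by rewrite ler_wpM2r.
  rewrite RintegralD//; [|by apply: intbleZ; exact: ih|by apply: intbleZ; exact: iq].
  have -> : \int[m]_x (e' * h t x) = e' * \int[m]_x h t x.
    exact: RintegralZl (ih t t0).
  have -> : \int[m]_x (C * (q x * h t x)) = C * \int[m]_x (q x * h t x).
    exact: RintegralZl (iq t t0).
  rewrite [e]splitr lerD//; last by near: t.
  apply: (@le_trans _ _ (e' * (`|N| + 1))).
    by have e'1 := ltW e'0; rewrite ler_wpM2l//; near: t.
  by rewrite /e' divfK// gt_eqF.
rewrite -[X in _ --> X]add0r.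
have lim : (\int[m]_x ((psi x - l) * h t x) + (\int[m]_x h t x) * l)
    @[t --> +oo] --> 0 + N * l.
  by apply: cvgD => //; apply: cvgM => //; exact: cvg_cst.
apply: cvg_trans lim; apply: near_eq_cvg; near=> t.
have t0 : 0 <= t by near: t; apply: nbhs_pinfty_ge; rewrite num_real.
rewrite /= [X in _ + X]mulrC -RintegralZl//; last exact: ih.
rewrite -RintegralD//; [|exact: idif|by apply: intbleZ; exact: ih].
by apply: eq_Rintegral => x _; ring.
Unshelve. all: by end_near. Qed.
End ConcentratingFamily.

Section TestFunctions.
Context {R : realType}.
Local Notation TR := (measurableTypeR R).
Local Notation TRR := (measurableTypeR R * measurableTypeR R)%type.

(** Within the distance [r] where continuity makes the difference at most [e]
    nothing else is needed; beyond it, the bound [2 * B] on the difference is at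
    most [2 * B / r ^+ 2 * `|x - a| ^+ 2]. *)
Lemma continuous_quadratic_modulus (V : normedModType R) (psi : V -> R) (a : V)
    (B : R) : {for a, continuous psi} -> (forall x, `|psi x| <= B) ->
  forall e : R, 0 < e -> exists2 C : R, 0 <= C &
    forall x, `|psi x - psi a| <= e + C * `|x - a| ^+ 2.
Proof.
move=> /cvgrPdist_le ca psiB e e0.
have B0 : 0 <= B := le_trans (normr_ge0 _) (psiB a).
have [r /= r0 ra] := (nbhs_ballP _ _).1 (ca e e0).
have C0 : 0 <= 2 * B / r ^+ 2 by apply: divr_ge0; [exact: mulr_ge0|exact: sqr_ge0].
exists (2 * B / r ^+ 2) => //.
move=> x; have [xr|rx] := ltP `|x - a| r.
  apply: (@le_trans _ _ e).
    rewrite distrC; apply: ra; rewrite -ball_normE /ball_ /=.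
    by rewrite distrC.
  by rewrite lerDl mulr_ge0// sqr_ge0.
apply: (@le_trans _ _ (2 * B)).
  by rewrite (le_trans (ler_normB _ _))// mulr_natl mulr2n lerD.
apply: (@le_trans _ _ (2 * B / r ^+ 2 * `|x - a| ^+ 2)); last by rewrite lerDr ltW.
rewrite -mulrA ler_peMr ?mulr_ge0// mulrC ler_pdivlMr ?exprn_gt0// mul1r.
by rewrite ler_pXn2r ?nnegrE// ltW.
Qed.

Lemma test_function_bounded (V : normedModType R) (psi : V -> R) :
  test_function psi -> exists B : R, forall x, `|psi x| <= B.
Proof.
move=> [/(_ 0%N)[cpsi _] [K [cK psi0]]].
have := continuous_compact (continuous_subspaceT cpsi : {within K, continuous psi}) cK.
move=> /compact_bounded[B [_ BP]].
exists (Num.max (B + 1) 0) => x.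
have [Kx|nKx] := pselect (K x).
  rewrite le_max; apply/orP; left; apply: (BP (B + 1)); first by rewrite ltrDl.
  by exists x.
by rewrite psi0// normr0 le_max lexx orbT.
Qed.

(** An open set is the union of the rectangles with rational data that it
    contains, of which there are countably many. *)
Lemma open_measurable_plane (U : set (R * R)) : open U ->
  measurable (U : set TRR).
Proof.
move=> oU.
pose box (i : rat * rat * rat) : set TRR :=
  `](ratr i.1.1 - ratr i.2), (ratr i.1.1 + ratr i.2)[%classic `*`
  `](ratr i.1.2 - ratr i.2), (ratr i.1.2 + ratr i.2)[%classic.
pose F (i : rat * rat * rat) : set TRR := if `[< box i `<=` U >] then box i else set0.
have -> : U = \bigcup_i F i.
  apply/seteqP; split => [[x y] Uxy|p [i _]]; last first.
    by rewrite /F; case: ifPn => // /asboolP; apply.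
  have [e /= e0 eU] := (nbhs_ballP _ _).1 (oU _ Uxy).
  have [r] := @rat_in_itvoo R (e / 4) (e / 2) ltac:(lra).
  rewrite in_itv/= => /andP[r1 r2].
  have [a] := @rat_in_itvoo R (x - e / 4) (x + e / 4) ltac:(lra).
  rewrite in_itv/= => /andP[a1 a2].
  have [b] := @rat_in_itvoo R (y - e / 4) (y + e / 4) ltac:(lra).
  rewrite in_itv/= => /andP[b1 b2].
  exists (a, b, r) => //; rewrite /F asboolT.
    by split; rewrite /= in_itv/=; apply/andP; split; lra.
  move=> [x' y'] [] /=; rewrite !in_itv/= => /andP[u1 u2] /andP[v1 v2].
  apply: eU; split; rewrite /= /ball /= ltr_norml; apply/andP; split; lra.
apply: countable_bigcupT_measurable => // i; rewrite /F; case: ifP => // _.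
by apply: measurableX; exact: measurable_itv.
Qed.

Lemma continuous_measurable_plane (psi : R * R -> R) : continuous psi ->
  measurable_fun [set: TRR] psi.
Proof.
move=> /continuousP cpsi; apply: (measurability _ (RGenOpens.measurableE R)).
move=> _ [_ [a [b ->] <-]]; rewrite setTI; apply: open_measurable_plane.
exact/cpsi/interval_open.
Qed.
End TestFunctions.

(** * Scalar equations for moments *)

Section Moments.
Context {R : realType}.
Local Notation mu := (@lebesgue_measure R).
Local Notation TR := (measurableTypeR R).
Local Notation TRR := (measurableTypeR R * measurableTypeR R)%type.
Local Notation mu2 := (@lebesgue2 R).
Local Notation "'cont0' u" := {within `[0%R, +oo[, continuous u}
  (at level 10, u at level 9).
Local Notation intble1 u := (mu.-integrable setT (EFin \o u)).
Local Notation intble2 u := (mu2.-integrable setT (EFin \o u)).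

Variables (lambda gamma : R) (f0 : TR -> R) (g0 : TRR -> R)
  (f : R -> TR -> R) (g : R -> TRR -> R) (Mf Mg : R -> R).
Hypotheses (lambda0 : 0 < lambda) (gamma0 : 0 < gamma).
Hypotheses (mf0 : measurable_fun setT f0) (mg0 : measurable_fun setT g0)
  (mf : measurable_fun setT (fun q : TR * TR => f q.1 q.2))
  (mg : measurable_fun setT (fun q : TR * TRR => g q.1 q.2)).
Hypotheses (f0_ge0 : forall x, 0 <= f0 x) (g0_ge0 : forall p, 0 <= g0 p)
  (f_ge0 : forall t x, 0 <= f t x) (g_ge0 : forall t p, 0 <= g t p).
Hypothesis g0_sym : forall x y, g0 (x, y) = g0 (y, x).
Hypothesis masses : mass_system lambda gamma f0 g0 Mf Mg.
Let A := cumulated_rate lambda Mf.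
Hypothesis fE : forall t : R, 0 <= t -> {ae mu, forall x : TR,
  (f t x)%:E = (expR (- A t) * f0 x)%:E +
    (2 * gamma)%:E * \int[mu]_(s in `[0%R, t])
      ((expR (- (A t - A s)))%:E * \int[mu]_y (g s (x, y))%:E)}%E.
Hypothesis gE : forall t : R, 0 <= t -> {ae mu2, forall p : TRR,
  (g t p)%:E = (semigroup gamma t g0 p)%:E +
    lambda%:E * \int[mu]_(s in `[0%R, t])
      (semigroup gamma (t - s) (fun q => f s q.1 * f s q.2)%R p)%:E}%E.
Hypotheses (f_int : forall t : R, 0 <= t -> intble1 (f t))
  (g_int : forall t : R, 0 <= t -> intble2 (g t)).
Hypotheses (f_cont : forall (w : TR -> R) (C : R), measurable_fun setT w ->
    (forall x, `|w x| <= C) -> cont0 (fun t => \int[mu]_x (w x * f t x)))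
  (g_cont : forall (w : TRR -> R) (C : R), measurable_fun setT w ->
    (forall p, `|w p| <= C) -> cont0 (fun t => \int[mu2]_p (w p * g t p))).

Hypotheses
  (f0_mom : (\int[mu]_x ((1 + x ^+ 2) * f0 x)%:E < +oo)%E)
  (g0_mom : (\int[mu2]_p ((1 + p.1 ^+ 2) * g0 p)%:E < +oo)%E).

Let cMf : cont0 Mf.
Proof. by case: masses => -[]. Qed.

Let cA : cont0 A.
Proof. exact: cumulated_rate_continuous. Qed.

Let mA : measurable_fun [set: TR] A.
Proof. exact: measurable_cumulated_rate. Qed.

Let mft (t : R) : measurable_fun setT (f t).
Proof. exact: (measurable_fun_pair2 t mf). Qed.

Let mgt (t : R) : measurable_fun setT (g t).
Proof. exact: (measurable_fun_pair2 t mg). Qed.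

Lemma moment_f_duhamel (w : TR -> R) :
  measurable_fun setT w -> (forall x, 0 <= w x) ->
  intble1 (fun x => w x * f0 x) ->
  (forall t : R, 0 <= t -> intble1 (fun x => w x * f t x)) ->
  (forall t : R, 0 <= t -> intble2 (fun p => w p.1 * g t p)) ->
  (forall T : R, mu.-integrable `[0, T]
     (EFin \o (fun s => \int[mu2]_p (w p.1 * g s p)))) ->
  forall t : R, 0 <= t -> \int[mu]_x (w x * f t x) =
    duhamel A (\int[mu]_x (w x * f0 x))
      (fun s => 2 * gamma * \int[mu2]_p (w p.1 * g s p)) t.
Proof.
move=> mw w0 iw0 iwf iwg ib t t0.
have mI : measurable (`[0%R, t] : set TR) by exact: measurable_itv.
apply: EFin_inj; rewrite -EFin_Rintegral; last exact: iwf.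
rewrite (weak_f gamma0 mA mf0 mf mg f0_ge0 f_ge0 g_ge0 fE mw w0 t0).
rewrite (EFin_Rintegral iw0) /duhamel EFinD EFinM; congr (_ + _)%E.
pose b s := expR (- (A t - A s)) * \int[mu2]_p (w p.1 * g s p).
have ibt : mu.-integrable `[0, t] (EFin \o b) by exact: integrable_duhamel.
transitivity ((2 * gamma)%:E * \int[mu]_(s in `[0%R, t]) (b s)%:E)%E.
  suff E : (\int[mu]_(s in `[0%R, t]) ((expR (- (A t - A s)))%:E *
      \int[mu2]_p (w p.1 * g s p)%:E))%E = (\int[mu]_(s in `[0%R, t]) (b s)%:E)%E.
    by rewrite E; reflexivity.
  apply: eq_integral => s; rewrite inE/= in_itv/= => /andP[s0 st].
  by rewrite (EFin_Rintegral (iwg _ s0)).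
have -> : (\int[mu]_(s in `[0%R, t]) (b s)%:E)%E = (\int[mu]_(s in `[0%R, t]) b s)%:E.
  by rewrite /Rintegral fineK//; exact: integrable_fin_num ibt.
rewrite -EFinM -RintegralZl//; congr (_%:E).
by apply: eq_Rintegral => s _; rewrite /b; ring.
Qed.

(** The equation closes for weights that the flow multiplies by an exponential:
    [kappa] is 0 for functions of the mean of a pair, and 2 for the square of its
    half-difference. *)
Lemma moment_g_duhamel (w : TRR -> R) (kappa : R) :
  measurable_fun setT w -> (forall p, 0 <= w p) ->
  (forall (t : R) p, w (flow t p) = expR (- (kappa * t)) * w p) ->
  intble2 (fun p => w p * g0 p) ->
  (forall t : R, 0 <= t -> intble2 (fun p => w p * g t p)) ->
  (forall t : R, 0 <= t -> intble2 (fun p => w p * (f t p.1 * f t p.2))) ->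
  (forall T : R, mu.-integrable `[0, T]
     (EFin \o (fun s => \int[mu2]_p (w p * (f s p.1 * f s p.2))))) ->
  forall t : R, 0 <= t -> \int[mu2]_p (w p * g t p) =
    duhamel (fun t => (gamma + kappa) * t) (\int[mu2]_p (w p * g0 p))
      (fun s => lambda * \int[mu2]_p (w p * (f s p.1 * f s p.2))) t.
Proof.
move=> mw w0 wflow iw0 iwg iwf ib t t0.
have mI : measurable (`[0%R, t] : set TR) by exact: measurable_itv.
apply: EFin_inj; rewrite -EFin_Rintegral; last exact: iwg.
rewrite (weak_g lambda0 mg0 mf mg g0_ge0 f_ge0 g_ge0 gE mw w0 t0).
rewrite /duhamel EFinD; congr (_ + _)%E.
  under eq_integral do rewrite wflow -mulrA EFinM.
  rewrite integralZl// (EFin_Rintegral iw0) -!EFinM mulrA -expRD.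
  by congr ((expR _ * _)%:E); ring.
pose b s := expR (- ((gamma + kappa) * t - (gamma + kappa) * s)) *
  \int[mu2]_p (w p * (f s p.1 * f s p.2)).
have ibt : mu.-integrable `[0, t] (EFin \o b).
  by apply: (integrable_duhamel (A := fun s => (gamma + kappa) * s));
    [exact: cont0_scale|exact: ib].
transitivity (lambda%:E * \int[mu]_(s in `[0%R, t]) (b s)%:E)%E.
  suff E : (\int[mu]_(s in `[0%R, t]) ((expR (- (gamma * (t - s))))%:E *
      \int[mu2]_p (w (flow (t - s) p) * (f s p.1 * f s p.2))%:E))%E =
      (\int[mu]_(s in `[0%R, t]) (b s)%:E)%E.
    by rewrite E; reflexivity.
  apply: eq_integral => s; rewrite inE/= in_itv/= => /andP[s0 st].
  under eq_integral do rewrite wflow -mulrA EFinM.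
  rewrite integralZl//; last exact: iwf.
  rewrite (EFin_Rintegral (iwf _ s0)) -!EFinM mulrA -expRD.
  by rewrite /b; congr ((expR _ * _)%:E); ring.
have -> : (\int[mu]_(s in `[0%R, t]) (b s)%:E)%E = (\int[mu]_(s in `[0%R, t]) b s)%:E.
  by rewrite /Rintegral fineK//; exact: integrable_fin_num ibt.
rewrite -EFinM -RintegralZl//; congr (_%:E).
by apply: eq_Rintegral => s _; rewrite /b; ring.
Qed.

Lemma f0_quadratic (w : TR -> R) (K : R) : measurable_fun setT w ->
  (forall x, `|w x| <= K * (1 + x ^+ 2)) -> intble1 (fun x => w x * f0 x).
Proof.
move=> mw wK.
have mq : measurable_fun [set: TR] (fun x : TR => (1 + x ^+ 2) * f0 x).
  by apply: measurable_funM => //; apply: measurable_funD => //; exact: measurable_funX.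
have i0 : intble1 (fun x => (1 + x ^+ 2) * f0 x).
  by apply: ge0_intble => // x; rewrite mulr_ge0// addr_ge0// sqr_ge0.
apply: dominated_intble (intbleZ K i0) _; first exact: measurable_funM.
by move=> x; rewrite normrM mulrA (ger0_norm (f0_ge0 x)) ler_wpM2r.
Qed.

Lemma g0_quadratic (w : TRR -> R) (K : R) : measurable_fun setT w ->
  (forall p, `|w p| <= K * (1 + p.1 ^+ 2 + p.2 ^+ 2)) ->
  intble2 (fun p => w p * g0 p).
Proof.
move=> mw wK.
have K0 : 0 <= K.
  have := le_trans (normr_ge0 _) (wK (0, 0)).
  by rewrite /= expr0n/= !addr0 mulr1.
have m1 : measurable_fun [set: TRR] (fun p : TRR => (1 + p.1 ^+ 2) * g0 p).
  apply: measurable_funM => //; apply: measurable_funD => //.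
  by apply: measurable_funX; exact: measurable_fst.
have m2 : measurable_fun [set: TRR] (fun p : TRR => (1 + p.2 ^+ 2) * g0 p).
  apply: measurable_funM => //; apply: measurable_funD => //.
  by apply: measurable_funX; exact: measurable_snd.
have i1 : intble2 (fun p => (1 + p.1 ^+ 2) * g0 p).
  by apply: ge0_intble => // p; rewrite mulr_ge0// addr_ge0// sqr_ge0.
have i2 : intble2 (fun p => (1 + p.2 ^+ 2) * g0 p).
  apply: ge0_intble => // [p|]; first by rewrite mulr_ge0// addr_ge0// sqr_ge0.
  apply: le_lt_trans g0_mom.
  rewrite -(@ge0_integral_swap R (fun p => ((1 + p.1 ^+ 2) * g0 p)%:E)).
  - rewrite le_eqVlt; apply/orP; left; apply/eqP.
    by apply: eq_integral => -[x y] _; rewrite /= g0_sym.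
  - exact/measurable_EFinP.
  - by move=> p; rewrite lee_fin mulr_ge0// addr_ge0// sqr_ge0.
apply: dominated_intble (intbleZ K (intbleD i1 i2)) _.
  exact: measurable_funM.
move=> p; rewrite normrM (ger0_norm (g0_ge0 p)) -mulrDl mulrA ler_wpM2r//.
apply: (le_trans (wK p)); rewrite ler_wpM2l//.
by lra.
Qed.

Let f0_int : intble1 f0.
Proof.
have : intble1 (fun x => cst 1 x * f0 x).
  by apply: (@f0_quadratic _ 1) => // x; rewrite normr1 mul1r lerDl sqr_ge0.
by apply: eq_integrable => // x _; rewrite /= mul1r.
Qed.

Let g0_int : intble2 g0.
Proof.
have : intble2 (fun x => cst 1 x * g0 x).
  by apply: (@g0_quadratic _ 1) => // x; rewrite normr1 mul1r -addrA lerDl addr_ge0// sqr_ge0.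
by apply: eq_integrable => // x _; rewrite /= mul1r.
Qed.

(** * Masses *)

Let nf (t : R) := \int[mu]_x f t x.
Let ng (t : R) := \int[mu2]_p g t p.

Let nf_cont : cont0 nf.
Proof.
have : cont0 (fun t => \int[mu]_x (cst 1 x * f t x)).
  by apply: (@f_cont _ 1) => // x; rewrite normr1.
by apply: cont0_eq => t _; apply: eq_Rintegral => x _; exact: mul1r.
Qed.

Let ng_cont : cont0 ng.
Proof.
have : cont0 (fun t => \int[mu2]_x (cst 1 x * g t x)).
  by apply: (@g_cont _ 1) => // x; rewrite normr1.
by apply: cont0_eq => t _; apply: eq_Rintegral => x _; exact: mul1r.
Qed.

Let Mf0 : Mf 0 = \int[mu]_x f0 x. Proof. by case: masses. Qed.
Let Mg0 : Mg 0 = \int[mu2]_p g0 p. Proof. by case: masses. Qed.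

Let int1_mul1 (u : TR -> R) : \int[mu]_x (1 * u x) = \int[mu]_x u x.
Proof. by apply: eq_Rintegral => x _; rewrite mul1r. Qed.

Let int2_mul1 (u : TRR -> R) : \int[mu2]_p (1 * u p) = \int[mu2]_p u p.
Proof. by apply: eq_Rintegral => x _; rewrite mul1r. Qed.

Let intble1_mul1 (u : TR -> R) : intble1 u -> intble1 (fun x => 1 * u x).
Proof. exact: intbleZ. Qed.

Let intble2_mul1 (u : TRR -> R) : intble2 u -> intble2 (fun x => 1 * u x).
Proof. exact: intbleZ. Qed.

Let nfE (t : R) : 0 <= t ->
  nf t = duhamel A (Mf 0) (fun s => 2 * gamma * ng s) t.
Proof.
move=> t0; transitivity (\int[mu]_x (1 * f t x)); first by rewrite int1_mul1.
transitivity (duhamel A (\int[mu]_x (1 * f0 x))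
    (fun s => 2 * gamma * \int[mu2]_p (1 * g s p)) t).
  apply: (@moment_f_duhamel (cst 1)) => //.
  - exact: intble1_mul1.
  - by move=> s s0; apply: intble1_mul1; exact: f_int.
  - by move=> s s0; apply: intble2_mul1; exact: g_int.
  - move=> T; apply: eq_integrable (continuous0_integrable T ng_cont) => //.
    by move=> s _ /=; rewrite int2_mul1.
rewrite int1_mul1 -Mf0; congr (duhamel _ _ _ t); apply/funext => s.
by rewrite int2_mul1.
Qed.

Let nf_sqr (t : R) : 0 <= t ->
  intble2 (fun p => f t p.1 * f t p.2) /\
  \int[mu2]_p (f t p.1 * f t p.2) = nf t ^+ 2.
Proof. by move=> t0; apply: integrable_tensor; exact: f_int. Qed.

Let ngE (t : R) : 0 <= t -> ng t =
  duhamel (fun t => gamma * t) (Mg 0) (fun s => lambda * nf s ^+ 2) t.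
Proof.
move=> t0.
have ffE s : 0 <= s -> \int[mu2]_p (1 * (f s p.1 * f s p.2)) = nf s ^+ 2.
  by move=> s0; rewrite int2_mul1 (nf_sqr s0).2.
transitivity (\int[mu2]_p (1 * g t p)); first by rewrite int2_mul1.
transitivity (duhamel (fun t => (gamma + 0) * t) (\int[mu2]_p (1 * g0 p))
    (fun s => lambda * \int[mu2]_p (1 * (f s p.1 * f s p.2))) t).
  apply: (@moment_g_duhamel (cst 1)) => //.
  - by move=> s p; rewrite mul0r oppr0 expR0 mulr1.
  - exact: intble2_mul1.
  - by move=> s s0; apply: intble2_mul1; exact: g_int.
  - by move=> s s0; apply: intble2_mul1; exact: (nf_sqr s0).1.
  - move=> T.
    apply: eq_integrable (continuous0_integrable T (cont0M nf_cont nf_cont)) => //.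
    by move=> s; rewrite inE/= in_itv/= => /andP[s0 _] /=; rewrite ffE.
rewrite int2_mul1 -Mg0 addr0 /duhamel; congr (_ + _); apply: eq_Rintegral => s.
by rewrite inE/= in_itv/= => /andP[s0 _]; rewrite ffE.
Qed.

Let dA (t : R) : 0 < t -> is_derive t 1 A (2 * lambda * Mf t).
Proof. exact: cumulated_rate_derive. Qed.

Let Mf_derive (t : R) : 0 < t ->
  is_derive t 1 Mf (2 * gamma * Mg t - 2 * lambda * Mf t ^+ 2).
Proof. by case: masses => _ + _ _ _; exact. Qed.

Let Mg_derive (t : R) : 0 < t ->
  is_derive t 1 Mg (lambda * Mf t ^+ 2 - gamma * Mg t).
Proof. by case: masses => _ _ + _ _; exact. Qed.

Let cMg : cont0 Mg.
Proof. by case: masses => -[]. Qed.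

(** The weight 1 gives [nf' = - 2 lambda Mf nf + 2 gamma ng] and
    [ng' = - gamma ng + lambda nf ^ 2], and [(Mf, Mg)] is another solution of this
    system with the same initial value. The sum of the squares of the differences
    satisfies a Gronwall inequality. *)
Lemma massesE (t : R) : 0 <= t -> nf t = Mf t /\ ng t = Mg t.
Proof.
move=> t0.
have nf_derive (s : R) : 0 < s ->
    is_derive s 1 nf (- (2 * lambda * Mf s) * nf s + 2 * gamma * ng s).
  apply: duhamel_eq_derive cA dA _ nfE; apply: cont0M => //; exact: cont0_cst.
have ng_derive (s : R) : 0 < s ->
    is_derive s 1 ng (- gamma * ng s + lambda * nf s ^+ 2).
  apply: (duhamel_eq_derive (a := fun=> gamma) (@cont0_scale R gamma) _ _ ngE).
  - by move=> ? _; exact: is_derive_scale.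
  - apply: cont0M; first exact: cont0_cst.
    exact: (cont0M nf_cont nf_cont).
pose z s := (nf s - Mf s) ^+ 2 + (ng s - Mg s) ^+ 2.
(* With this [k], the difference [k * z - z'] is a sum of squares with
   nonnegative coefficients. *)
pose c s := 4 * gamma + 2 * lambda * (nf s + Mf s).
pose k s := 4 * lambda * (Mf s ^+ 2 + 1) + (c s ^+ 2 + 1).
pose z' s := 2 * (nf s - Mf s) * ((- (2 * lambda * Mf s) * nf s + 2 * gamma * ng s)
      - (2 * gamma * Mg s - 2 * lambda * Mf s ^+ 2))
  + 2 * (ng s - Mg s) * ((- gamma * ng s + lambda * nf s ^+ 2)
      - (lambda * Mf s ^+ 2 - gamma * Mg s)).
have cd := cont0D nf_cont (cont0N cMf).
have ce := cont0D ng_cont (cont0N cMg).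
have cz : cont0 z by exact: cont0D (cont0M cd cd) (cont0M ce ce).
have dz (s : R) : 0 < s -> is_derive s 1 z (z' s).
  move=> s0.
  have d1 := is_deriveB (nf_derive s s0) (Mf_derive s0).
  have d2 := is_deriveB (ng_derive s s0) (Mg_derive s0).
  have := is_deriveD (is_deriveX 2 d1) (is_deriveX 2 d2).
  by move=> /is_derive_eq; apply; rewrite /z' /GRing.scale/= !expr1.
have ck : cont0 k.
  have cc : cont0 c.
    apply: cont0D; first exact: cont0_cst.
    by apply: cont0M (cont0D nf_cont cMf); exact: cont0_cst.
  apply: cont0D; last by apply: cont0D (cont0M cc cc) _; exact: cont0_cst.
  apply: cont0M; first exact: cont0_cst.
  by apply: cont0D (cont0M cMf cMf) _; exact: cont0_cst.
have z0 : z 0 = 0.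
  rewrite /z nfE// ngE// /duhamel !set_itv1 !Rintegral_set1 !addr0.
  rewrite /A (cumulated_rate_le0 lambda Mf (lexx 0)) mulr0 oppr0 expR0 !mul1r.
  by rewrite !subrr expr0n addr0.
have zk (s : R) : 0 < s -> z' s <= k s * z s.
  move=> _; rewrite -subr_ge0.
  set d := nf s - Mf s; set e := ng s - Mg s.
  have -> : k s * z s - z' s = 4 * lambda * (Mf s ^+ 2 + 1) * e ^+ 2 +
      2 * gamma * e ^+ 2 + 4 * lambda * ((Mf s + 1 / 2) ^+ 2 + 3 / 4) * d ^+ 2 +
      ((c s * d - e / 2) ^+ 2 + (c s * e) ^+ 2 + d ^+ 2 + 3 / 4 * e ^+ 2).
    by rewrite /k /z /z' /c /d /e; field.
  have l0 := ltW lambda0; have g0' := ltW gamma0.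
  repeat (apply: sqr_ge0 || apply: addr_ge0 || apply: mulr_ge0); lra.
have := gronwall_null cz dz ck z0 zk t0.
rewrite /z => zt.
have d0 : (nf t - Mf t) ^+ 2 = 0.
  apply/eqP; rewrite eq_le sqr_ge0 andbT (le_trans _ zt)// lerDl sqr_ge0//.
have e0 : (ng t - Mg t) ^+ 2 = 0.
  apply/eqP; rewrite eq_le sqr_ge0 andbT (le_trans _ zt)// lerDr sqr_ge0//.
by move/eqP: d0; move/eqP: e0; rewrite !sqrf_eq0 !subr_eq0 => /eqP -> /eqP ->.
Qed.

Lemma Mf_ge0 (t : R) : 0 <= t -> 0 <= Mf t.
Proof. by move=> t0; rewrite -(massesE t0).1; apply: Rintegral_ge0. Qed.

Lemma Mg_ge0 (t : R) : 0 <= t -> 0 <= Mg t.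
Proof. by move=> t0; rewrite -(massesE t0).2; apply: Rintegral_ge0. Qed.

Let M := Mf 0 + 2 * Mg 0.

Lemma total_mass (t : R) : 0 <= t -> Mf t + 2 * Mg t = M.
Proof.
move=> t0; pose u s := Mf s + 2 * Mg s.
have cu : cont0 u.
  by apply: cont0D cMf _; apply: cont0M cMg; exact: cont0_cst.
have du (s : R) : 0 < s -> is_derive s 1 u 0.
  move=> s0; have := is_deriveD (Mf_derive s0) (is_deriveZ 2 (Mg_derive s0)).
  by move=> /is_derive_eq; apply; rewrite /GRing.scale/=; ring.
exact: (constant_halfline cu du t0).
Qed.

Let M_ge0 : 0 <= M.
Proof. by rewrite addr_ge0 ?mulr_ge0 ?Mf_ge0 ?Mg_ge0. Qed.

Lemma Mf_le (t : R) : 0 <= t -> Mf t <= M.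
Proof. by move=> t0; rewrite -(total_mass t0) lerDl mulr_ge0// Mg_ge0. Qed.

Let A_nondecreasing (s t : R) : 0 <= s -> s <= t -> A s <= A t.
Proof.
move=> s0 st; rewrite -lerN2.
have dNA (x : R) : 0 < x -> is_derive x 1 (fun x => - A x) (- (2 * lambda * Mf x)).
  by move=> x0; exact: is_deriveN (dA x0).
apply: (nonincreasing_after s0 (cont0N cA) dNA _ st) => x sx.
have x0 := le_trans s0 (ltW sx).
by rewrite oppr_le0 mulr_ge0 ?Mf_ge0// mulr_ge0// ltW.
Qed.

Let A_ge0 (t : R) : 0 <= t -> 0 <= A t.
Proof.
move=> t0; rewrite -(cumulated_rate_le0 lambda Mf (lexx 0)).
exact: A_nondecreasing.
Qed.

Lemma measurable_moment_g (w : TRR -> R) : measurable_fun setT w ->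
  (forall p, 0 <= w p) ->
  measurable_fun [set: TR] (fun s => \int[mu2]_p (w p * g s p)).
Proof.
move=> mw w0; apply: (measurableT_comp (fine_measurable measurableT)).
apply: (@measurable_fun_fubini_tonelli_F _ _ _ _ R mu2
  (fun q : TR * TRR => (w q.2 * g q.1 q.2)%:E)).
  apply/measurable_EFinP; apply: measurable_funM => //.
  exact: measurableT_comp.
by move=> q; rewrite lee_fin mulr_ge0.
Qed.

Lemma measurable_moment_ff (w : R -> TRR -> R) :
  measurable_fun setT (fun q : TR * TRR => w q.1 q.2) ->
  (forall s p, 0 <= w s p) ->
  measurable_fun [set: TR]
    (fun s => \int[mu2]_p (w s p * (f s p.1 * f s p.2))%:E)%E.
Proof.
move=> mw w0.
apply: (@measurable_fun_fubini_tonelli_F _ _ _ _ R mu2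
  (fun q : TR * TRR => (w q.1 q.2 * (f q.1 q.2.1 * f q.1 q.2.2))%:E)).
  apply/measurable_EFinP; apply: measurable_funM => //.
  have m1 : measurable_fun setT (fun q : TR * TRR => (q.1, q.2.1)).
    by apply: measurable_fun_pair => //; exact: measurableT_comp.
  have m2 : measurable_fun setT (fun q : TR * TRR => (q.1, q.2.2)).
    by apply: measurable_fun_pair => //; exact: measurableT_comp.
  by apply: measurable_funM; [exact: (measurableT_comp mf m1)
                             |exact: (measurableT_comp mf m2)].
by move=> q; rewrite lee_fin mulr_ge0// mulr_ge0.
Qed.

(** * Finiteness of the second moments *)

Section Truncation.
Variable n : nat.

Let w (x : R) : R := Num.min (x ^+ 2) n%:R.
Let W (p : TRR) : R := w p.1 + w p.2.

Let mw : measurable_fun [set: TR] w.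
Proof. by apply: measurable_minr => //; exact: measurable_funX. Qed.

Let mW : measurable_fun [set: TRR] W.
Proof. by apply: measurable_funD; exact: measurableT_comp. Qed.

Let w_ge0 x : 0 <= w x.
Proof. by rewrite le_min sqr_ge0 ler0n. Qed.

Let W_ge0 p : 0 <= W p.
Proof. by rewrite addr_ge0. Qed.

Let w_le x : w x <= n%:R.
Proof. by rewrite ge_min lexx orbT. Qed.

Let w_sqr x : w x <= x ^+ 2.
Proof. by rewrite ge_min lexx. Qed.

Let w_norm x : `|w x| <= n%:R.
Proof. by rewrite ger0_norm. Qed.

Let W_norm p : `|W p| <= n%:R + n%:R.
Proof. by rewrite ger0_norm// lerD. Qed.

Let w_mono x y : x ^+ 2 <= y ^+ 2 -> w x <= w y.
Proof. by move=> xy; rewrite /w le_min w_le andbT (le_trans (w_sqr x)). Qed.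

(** The flow replaces both coordinates by convex combinations of them, at which
    [w] does not exceed the larger one of its values at the two. This bounds the
    growth of [W] along the flow by a factor that is uniform in time and in [n]. *)
Let w_combination (al be x y : R) : 0 <= al -> 0 <= be -> al + be = 1 ->
  w (al * x + be * y) <= w x + w y.
Proof.
move=> al0 be0 ab.
have E : (al * x + be * y) ^+ 2 =
    al * x ^+ 2 + be * y ^+ 2 - al * be * (x - y) ^+ 2.
  by have -> : al = 1 - be by [lra]; ring.
have ab0 : 0 <= al * be * (x - y) ^+ 2 by rewrite mulr_ge0 ?sqr_ge0// mulr_ge0.
have [xy|/ltW yx] := leP (x ^+ 2) (y ^+ 2).
  apply: (@le_trans _ _ (w y)); last by rewrite lerDr.
  apply: w_mono; apply: (@le_trans _ _ (al * x ^+ 2 + be * y ^+ 2)).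
    by rewrite E lerBlDr lerDl.
  have {2}-> : y ^+ 2 = al * y ^+ 2 + be * y ^+ 2 by rewrite -mulrDl ab mul1r.
  by rewrite lerD2r ler_wpM2l.
apply: (@le_trans _ _ (w x)); last by rewrite lerDl.
apply: w_mono; apply: (@le_trans _ _ (al * x ^+ 2 + be * y ^+ 2)).
  by rewrite E lerBlDr lerDl.
have {2}-> : x ^+ 2 = al * x ^+ 2 + be * x ^+ 2 by rewrite -mulrDl ab mul1r.
by rewrite lerD2l ler_wpM2l.
Qed.

Let W_flow (t : R) p : 0 <= t -> W (flow t p) <= 2 * W p.
Proof.
move=> t0; have e1 : expR (- t) <= 1 by rewrite -expR0 ler_expR oppr_le0.
have e0 := expR_gt0 (- t).
pose al := (1 + expR (- t)) / 2; pose be := (1 - expR (- t)) / 2.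
have al0 : 0 <= al by rewrite /al; lra.
have be0 : 0 <= be by rewrite /be; lra.
have ab : al + be = 1 by rewrite /al /be; field.
have -> : flow t p = (al * p.1 + be * p.2, be * p.1 + al * p.2).
  by rewrite /flow /al /be; congr (_, _); field.
rewrite /W /= mulr_natl mulr2n lerD//; first exact: w_combination.
by rewrite w_combination// addrC.
Qed.

Let v t := \int[mu]_x (w x * f t x).
Let b t := \int[mu2]_p (W p * g t p).

Let cv : cont0 v. Proof. exact: f_cont mw w_norm. Qed.
Let cb : cont0 b. Proof. exact: g_cont mW W_norm. Qed.

Let V0 := \int[mu]_x (x ^+ 2 * f0 x).
Let B0 := \int[mu2]_p ((p.1 ^+ 2 + p.2 ^+ 2) * g0 p).

Let intble_sqr_f0 : intble1 (fun x => x ^+ 2 * f0 x).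
Proof.
apply: (@f0_quadratic (fun x => x ^+ 2) 1) => [|x]; first exact: measurable_funX.
by rewrite mul1r ger0_norm ?sqr_ge0// lerDr.
Qed.

Let intble_sqr_g0 : intble2 (fun p => (p.1 ^+ 2 + p.2 ^+ 2) * g0 p).
Proof.
apply: (@g0_quadratic (fun p => p.1 ^+ 2 + p.2 ^+ 2) 1) => [|p].
  by apply: measurable_funD; apply: measurable_funX;
    [exact: measurable_fst|exact: measurable_snd].
by rewrite mul1r ger0_norm ?addr_ge0 ?sqr_ge0// -addrA lerDr.
Qed.

Let v_le (t : R) : 0 <= t -> v t <= V0 + 2 * gamma * \int[mu]_(s in `[0, t]) b s.
Proof.
move=> t0.
have mw1 : measurable_fun [set: TRR] (fun p : TRR => w p.1) by exact: measurableT_comp.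
have iwg (s : R) : 0 <= s -> intble2 (fun p => w p.1 * g s p).
  by move=> s0; apply: (bounded_intble mw1 (fun p => w_norm p.1)); exact: g_int.
have cc : cont0 (fun s => \int[mu2]_p (w p.1 * g s p)).
  exact: (g_cont mw1 (fun p => w_norm p.1)).
have iwf0 := bounded_intble mw w_norm f0_int.
rewrite /v (moment_f_duhamel mw w_ge0 iwf0) => //; last 2 first.
- by move=> s s0; apply: (bounded_intble mw w_norm); exact: f_int.
- by move=> T; exact: continuous0_integrable.
rewrite /duhamel lerD//.
  apply: (@le_trans _ _ (\int[mu]_x (w x * f0 x))).
    rewrite ler_piMl//; first by apply: Rintegral_ge0 => x _; rewrite mulr_ge0.
    by rewrite -expR0 ler_expR oppr_le0 A_ge0.
  by apply: le_Rintegral => // x _; rewrite ler_wpM2r.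
rewrite -RintegralZl//; last exact: continuous0_integrable.
apply: le_Rintegral => //.
- apply: integrable_duhamel => //; apply: continuous0_integrable.
  by apply: cont0M cc; exact: cont0_cst.
- apply: continuous0_integrable.
  by apply: cont0M cb; exact: cont0_cst.
move=> s /=; rewrite in_itv/= => /andP[s0 st].
have c_le : \int[mu2]_p (w p.1 * g s p) <= b s.
  apply: le_Rintegral => //; first exact: iwg.
    by apply: (bounded_intble mW W_norm); exact: g_int.
  by move=> p _; rewrite ler_wpM2r// lerDl.
have c0 : 0 <= \int[mu2]_p (w p.1 * g s p).
  by apply: Rintegral_ge0 => p _; rewrite mulr_ge0.
have g2 : 0 <= 2 * gamma by rewrite mulr_ge0// ltW.
apply: (@le_trans _ _ (2 * gamma * \int[mu2]_p (w p.1 * g s p))).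
  rewrite ler_piMl//; first exact: mulr_ge0.
  by rewrite -expR0 ler_expR oppr_le0 subr_ge0 A_nondecreasing.
by rewrite ler_wpM2l.
Qed.

Let W_ff (s : R) : 0 <= s ->
  intble2 (fun p => W p * (f s p.1 * f s p.2)) /\
  \int[mu2]_p (W p * (f s p.1 * f s p.2)) = 2 * v s * nf s.
Proof.
move=> s0; have iwf := bounded_intble mw w_norm (f_int s0).
have [i1 e1] := integrable_tensor iwf (f_int s0).
have [i2 e2] := integrable_tensor (f_int s0) iwf.
have WE p : W p * (f s p.1 * f s p.2) =
    w p.1 * f s p.1 * f s p.2 + f s p.1 * (w p.2 * f s p.2).
  by rewrite /W; ring.
split; first by apply: eq_integrable (intbleD i1 i2) => // p _; rewrite /= WE.
under eq_Rintegral do rewrite WE.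
by rewrite RintegralD// e1 e2 -/(v s) -/(nf s); ring.
Qed.

Let b_le (t : R) : 0 <= t ->
  b t <= 2 * B0 + 4 * lambda * M * \int[mu]_(s in `[0, t]) v s.
Proof.
move=> t0; rewrite -lee_fin -EFin_Rintegral; last first.
  by apply: (bounded_intble mW W_norm); exact: g_int.
rewrite (weak_g lambda0 mg0 mf mg g0_ge0 f_ge0 g_ge0 gE mW W_ge0 t0).
have mWf (s : R) : measurable_fun [set: TRR] (fun p => W (flow s p)).
  by apply: measurableT_comp => //; exact: measurable_flow.
have e_le1 (s : R) : s <= t -> expR (- (gamma * (t - s))) <= 1.
  by move=> st; rewrite -expR0 ler_expR oppr_le0 mulr_ge0 ?subr_ge0// ltW.
rewrite EFinD; apply: leeD.
  have B_le : (\int[mu2]_p (W (flow t p) * g0 p)%:E <= (2 * B0)%:E)%E.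
    rewrite -RintegralZl// -EFin_Rintegral; last exact: intbleZ.
    apply: ge0_le_integral => //.
    - by move=> p _; rewrite lee_fin mulr_ge0.
    - by apply/measurable_EFinP; exact: measurable_funM.
    - exact: (measurable_int _ (intbleZ 2 intble_sqr_g0)).
    - move=> p _; rewrite lee_fin mulrA ler_wpM2r//.
      by apply: (le_trans (W_flow p t0)); rewrite ler_wpM2l// lerD.
  have B_ge0 : 0 <= 2 * B0.
    by rewrite mulr_ge0// Rintegral_ge0// => p _; rewrite mulr_ge0// addr_ge0// sqr_ge0.
  apply: (le_trans (lee_wpmul2l _ B_le)); first by rewrite lee_fin expR_ge0.
  by rewrite -EFinM lee_fin ler_piMl//; have := e_le1 0 t0; rewrite subr0.
have -> : 4 * lambda * M * \int[mu]_(s in `[0, t]) v s =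
    lambda * \int[mu]_(s in `[0, t]) (4 * M * v s).
  by rewrite RintegralZl//; [ring|exact: continuous0_integrable].
have c4v : cont0 (fun s => 4 * M * v s) by apply: cont0M cv; exact: cont0_cst.
have i4v := continuous0_integrable t c4v.
rewrite EFinM; apply: lee_wpmul2l; first by rewrite lee_fin ltW.
have -> : (\int[mu]_(s in `[0%R, t]) (4 * M * v s))%:E =
    (\int[mu]_(s in `[0%R, t]) (4 * M * v s)%:E)%E.
  by rewrite /Rintegral fineK//; exact: integrable_fin_num i4v.
have mY : measurable_fun [set: TR]
    (fun s => \int[mu2]_p (W (flow (t - s) p) * (f s p.1 * f s p.2))%:E)%E.
  apply: (@measurable_moment_ff (fun s p => W (flow (t - s) p))) => //.
  apply: measurableT_comp => //; apply: measurable_flow_comp => //.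
  exact: measurable_funB.
apply: ge0_le_integral => //.
- move=> s _; rewrite mule_ge0 ?lee_fin ?expR_ge0// integral_ge0// => p _.
  by rewrite lee_fin mulr_ge0// mulr_ge0.
- apply: measurable_funTS; apply: emeasurable_funM => //.
  apply/measurable_EFinP; apply: measurable_expR_comp.
  by apply: measurableT_comp => //; apply: measurable_funM => //; exact: measurable_funB.
- by case/integrableP : i4v.
move=> s /=; rewrite in_itv/= => /andP[s0 st].
have [iWff eWff] := W_ff s0.
have v0 : 0 <= v s by apply: Rintegral_ge0 => x _; rewrite mulr_ge0.
have Y_le : (\int[mu2]_p (W (flow (t - s) p) * (f s p.1 * f s p.2))%:E <=
    (4 * M * v s)%:E)%E.
  apply: (@le_trans _ _ (\int[mu2]_p (2 * (W p * (f s p.1 * f s p.2)))%:E)%E).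
    apply: ge0_le_integral => //.
    - by move=> p _; rewrite lee_fin mulr_ge0// mulr_ge0.
    - apply/measurable_EFinP; apply: measurable_funM => //.
      by apply: measurable_funM; exact: measurableT_comp.
    - exact: (measurable_int _ (intbleZ 2 iWff)).
    - move=> p _; rewrite lee_fin [2 * _]mulrA ler_wpM2r//; first by rewrite mulr_ge0.
      by apply: W_flow; rewrite subr_ge0.
  rewrite EFin_Rintegral; last exact: intbleZ.
  rewrite lee_fin RintegralZl// eWff (massesE s0).1.
  rewrite [X in X <= _](_ : _ = 4 * v s * Mf s); last by ring.
  by rewrite -!mulrA ler_wpM2l// mulrC ler_wpM2r// Mf_le.
apply: (le_trans (lee_wpmul2l _ Y_le)); first by rewrite lee_fin expR_ge0.
by rewrite -EFinM lee_fin ler_piMl ?e_le1// mulr_ge0// mulr_ge0.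
Qed.

(** Truncated moments are finite and continuous in time, as Gronwall's inequality
    requires. Since [n] does not occur in the bound, it carries over to the
    moments without truncation. *)
Lemma truncated_second_moments (t : R) : 0 <= t ->
  v t + b t <= (V0 + 2 * B0) * expR ((2 * gamma + 4 * lambda * M) * t).
Proof.
move=> t0.
have l0 := ltW lambda0; have g0' := ltW gamma0.
have v0 (s : R) : 0 <= v s by apply: Rintegral_ge0 => x _; rewrite mulr_ge0.
have b0 (s : R) : 0 <= b s by apply: Rintegral_ge0 => x _; rewrite mulr_ge0.
have K0 : 0 < 2 * gamma + 4 * lambda * M.
  by apply: ltr_pwDl; [exact: mulr_gt0|rewrite !mulr_ge0].
apply: (gronwall_integral K0 (cont0D cv cb)) => // s s0.
have iv := continuous0_integrable s cv.
have ib := continuous0_integrable s cb.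
rewrite RintegralD//; apply: (le_trans (lerD (v_le s0) (b_le s0))).
set Iv := (X in _ + 4 * lambda * M * X); set Ib := (X in 2 * gamma * X).
have Iv0 : 0 <= Iv by exact: Rintegral_ge0.
have Ib0 : 0 <= Ib by exact: Rintegral_ge0.
have g1 : 0 <= 2 * gamma * Iv by rewrite !mulr_ge0.
have g2 : 0 <= 4 * lambda * M * Ib by rewrite !mulr_ge0.
have -> : (2 * gamma + 4 * lambda * M) * (Iv + Ib) =
    2 * gamma * Iv + 2 * gamma * Ib + (4 * lambda * M * Iv + 4 * lambda * M * Ib).
  by rewrite mulrDl !mulrDr.
lra.
Qed.
End Truncation.

Let E (t : R) := (\int[mu]_x (x ^+ 2 * f0 x) +
  2 * \int[mu2]_p ((p.1 ^+ 2 + p.2 ^+ 2) * g0 p)) *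
  expR ((2 * gamma + 4 * lambda * M) * t).

Let E_ge0 (t : R) : 0 <= E t.
Proof.
rewrite /E mulr_ge0 ?expR_ge0// addr_ge0 ?mulr_ge0//.
  by apply: Rintegral_ge0 => x _; rewrite mulr_ge0// sqr_ge0.
by apply: Rintegral_ge0 => p _; rewrite mulr_ge0// addr_ge0// sqr_ge0.
Qed.

Let E_mono (s t : R) : s <= t -> E s <= E t.
Proof.
move=> st; apply: ler_wpM2l.
  rewrite addr_ge0 ?mulr_ge0//.
    by apply: Rintegral_ge0 => x _; rewrite mulr_ge0// sqr_ge0.
  by apply: Rintegral_ge0 => p _; rewrite mulr_ge0// addr_ge0// sqr_ge0.
have l0 := ltW lambda0; have g0' := ltW gamma0.
by rewrite ler_expR ler_wpM2l// addr_ge0// !mulr_ge0.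
Qed.

Let sqr_f (t : R) : 0 <= t -> intble1 (fun x => x ^+ 2 * f t x) /\
  \int[mu]_x (x ^+ 2 * f t x) <= E t.
Proof.
move=> t0.
have mq : measurable_fun [set: TR] (fun x : TR => x ^+ 2) by exact: measurable_funX.
have E_le : (\int[mu]_x (x ^+ 2 * f t x)%:E <= (E t)%:E)%E.
  apply: truncation_limit => // [x|n]; first exact: sqr_ge0.
  have mw : measurable_fun [set: TR] (fun x : TR => Num.min (x ^+ 2) n%:R).
    exact: measurable_minr.
  have w0 x : 0 <= Num.min (x ^+ 2) n%:R :> R by rewrite le_min sqr_ge0 ler0n.
  rewrite EFin_Rintegral; last first.
    apply: (@bounded_intble _ _ _ _ _ _ n%:R) => //; last exact: f_int.
    by move=> x; rewrite ger0_norm// ge_min lexx orbT.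
  rewrite lee_fin (le_trans _ (truncated_second_moments n t0))// lerDl.
  by apply: Rintegral_ge0 => p _; rewrite mulr_ge0// addr_ge0.
have i2 : intble1 (fun x => x ^+ 2 * f t x).
  apply: ge0_intble => [|x|]; first exact: measurable_funM.
    by rewrite mulr_ge0// sqr_ge0.
  by apply: le_lt_trans E_le _; rewrite ltry.
by split => //; rewrite -lee_fin -EFin_Rintegral.
Qed.

Let sqr_g (h : TRR -> R) (t : R) : (h = fst \/ h = snd) -> 0 <= t ->
  intble2 (fun p => h p ^+ 2 * g t p) /\
  \int[mu2]_p (h p ^+ 2 * g t p) <= E t.
Proof.
move=> h12 t0.
have mh : measurable_fun [set: TRR] h by case: h12 => ->.
have mq : measurable_fun [set: TRR] (fun p => h p ^+ 2) by exact: measurable_funX.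
have E_le : (\int[mu2]_p (h p ^+ 2 * g t p)%:E <= (E t)%:E)%E.
  apply: truncation_limit => // [x|n]; first exact: sqr_ge0.
  have w0 x : 0 <= Num.min (x ^+ 2) n%:R :> R by rewrite le_min sqr_ge0 ler0n.
  have w_n x : `|Num.min (x ^+ 2) n%:R| <= n%:R :> R.
    by rewrite ger0_norm// ge_min lexx orbT.
  have mw : measurable_fun [set: TR] (fun x : TR => Num.min (x ^+ 2) n%:R).
    by apply: measurable_minr => //; exact: measurable_funX.
  have mwh : measurable_fun [set: TRR] (fun p => Num.min (h p ^+ 2) n%:R).
    exact: (measurableT_comp mw mh).
  have iwg := bounded_intble mwh (fun p => w_n (h p)) (g_int t0).
  rewrite EFin_Rintegral// lee_fin (le_trans _ (truncated_second_moments n t0))//.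
  apply: ler_wpDl; first by apply: Rintegral_ge0 => x _; rewrite mulr_ge0.
  apply: le_Rintegral => //.
    apply: (@bounded_intble _ _ _ _ _ _ (n%:R + n%:R)); last exact: g_int.
      by apply: measurable_funD; [exact: (measurableT_comp mw measurable_fst)
                                 |exact: (measurableT_comp mw measurable_snd)].
    by move=> p; rewrite ger0_norm ?addr_ge0// lerD// ge_min lexx orbT.
  by move=> p _; rewrite ler_wpM2r//; case: h12 => ->; rewrite ?lerDl ?lerDr.
have i2 : intble2 (fun p => h p ^+ 2 * g t p).
  apply: ge0_intble => [|x|]; first exact: measurable_funM.
    by rewrite mulr_ge0// sqr_ge0.
  by apply: le_lt_trans E_le _; rewrite ltry.
by split => //; rewrite -lee_fin -EFin_Rintegral.
Qed.

Let f_quad (t : R) : 0 <= t -> intble1 (fun x => (1 + x ^+ 2) * f t x) /\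
  \int[mu]_x ((1 + x ^+ 2) * f t x) <= M + E t.
Proof.
move=> t0; have [i2 e2] := sqr_f t0.
have -> : (fun x => (1 + x ^+ 2) * f t x) = (fun x => f t x + x ^+ 2 * f t x).
  by apply/funext => x; rewrite mulrDl mul1r.
split; first exact: intbleD (f_int t0) i2.
rewrite RintegralD//; last exact: f_int.
by rewrite lerD// -/(nf t) (massesE t0).1 Mf_le.
Qed.

Let g_quad (t : R) : 0 <= t ->
  intble2 (fun p => (1 + p.1 ^+ 2 + p.2 ^+ 2) * g t p) /\
  \int[mu2]_p ((1 + p.1 ^+ 2 + p.2 ^+ 2) * g t p) <= M + 2 * E t.
Proof.
move=> t0; have [i1 e1] := sqr_g (or_introl erefl) t0.
have [i2 e2] := sqr_g (or_intror erefl) t0.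
have -> : (fun p : TRR => (1 + p.1 ^+ 2 + p.2 ^+ 2) * g t p) =
    (fun p => g t p + (p.1 ^+ 2 * g t p + p.2 ^+ 2 * g t p)).
  by apply/funext => p; ring.
have i12 := intbleD i1 i2.
split; first exact: intbleD (g_int t0) i12.
rewrite RintegralD//; last exact: g_int.
rewrite RintegralD// mulr_natl mulr2n lerD//; last exact: lerD.
rewrite -/(ng t) (massesE t0).2 -(total_mass t0).
by have := Mf_ge0 t0; have := Mg_ge0 t0; lra.
Qed.

Let Rintegral_norm_le d (T : measurableType d)
    (m : {measure set T -> \bar R}) (w u q : T -> R) (K C : R) :
  measurable_fun setT w -> (forall x, 0 <= u x) -> measurable_fun setT u ->
  m.-integrable setT (EFin \o (fun x => q x * u x)) -> 0 <= K ->
  (forall x, `|w x| <= K * q x) -> \int[m]_x (q x * u x) <= C ->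
  m.-integrable setT (EFin \o (fun x => w x * u x)) /\
  `|\int[m]_x (w x * u x)| <= K * C.
Proof.
move=> mw u0 mu_ iq K0 wq qC.
have wu x : `|w x * u x| <= K * (q x * u x).
  by rewrite normrM (ger0_norm (u0 x)) mulrA ler_wpM2r.
have iw : m.-integrable setT (EFin \o (fun x => w x * u x)).
  by apply: dominated_intble (intbleZ K iq) wu; exact: measurable_funM.
split => //; apply: (le_trans (le_normr_Rintegral _ _)) => //.
apply: (@le_trans _ _ (\int[m]_x (K * (q x * u x)))).
  apply: le_Rintegral => //; first exact: integrable_norm.
  exact: intbleZ.
by rewrite RintegralZl// ler_wpM2l.
Qed.

Lemma f_quadratic (w : TR -> R) (K t : R) : measurable_fun setT w -> 0 <= K ->
  (forall x, `|w x| <= K * (1 + x ^+ 2)) -> 0 <= t ->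
  intble1 (fun x => w x * f t x) /\ `|\int[mu]_x (w x * f t x)| <= K * (M + E t).
Proof.
move=> mw K0 wK t0; have [iq qC] := f_quad t0.
exact: (Rintegral_norm_le mw _ (mft t) iq K0 wK qC).
Qed.

Lemma g_quadratic (w : TRR -> R) (K t : R) : measurable_fun setT w -> 0 <= K ->
  (forall p, `|w p| <= K * (1 + p.1 ^+ 2 + p.2 ^+ 2)) -> 0 <= t ->
  intble2 (fun p => w p * g t p) /\
  `|\int[mu2]_p (w p * g t p)| <= K * (M + 2 * E t).
Proof.
move=> mw K0 wK t0; have [iq qC] := g_quad t0.
exact: (Rintegral_norm_le mw _ (mgt t) iq K0 wK qC).
Qed.

Lemma ff_quadratic (w : TRR -> R) (K t : R) : measurable_fun setT w -> 0 <= K ->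
  (forall p, `|w p| <= K * (1 + p.1 ^+ 2 + p.2 ^+ 2)) -> 0 <= t ->
  intble2 (fun p => w p * (f t p.1 * f t p.2)) /\
  `|\int[mu2]_p (w p * (f t p.1 * f t p.2))| <= K * (M + E t) ^+ 2.
Proof.
move=> mw K0 wK t0; have [iq qC] := f_quad t0.
have [i2 e2] := integrable_tensor iq iq.
have qE : (fun p : TRR => (1 + p.1 ^+ 2) * (1 + p.2 ^+ 2) * (f t p.1 * f t p.2)) =
    (fun p => (1 + p.1 ^+ 2) * f t p.1 * ((1 + p.2 ^+ 2) * f t p.2)).
  by apply/funext => p; ring.
apply: (@Rintegral_norm_le _ _ mu2 w _
  (fun p => (1 + p.1 ^+ 2) * (1 + p.2 ^+ 2))) => //.
- by move=> p; rewrite mulr_ge0.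
- by apply: measurable_funM; exact: measurableT_comp.
- by rewrite qE.
- move=> p; apply: (le_trans (wK p)); rewrite ler_wpM2l//.
  have -> : (1 + p.1 ^+ 2) * (1 + p.2 ^+ 2) =
    1 + p.1 ^+ 2 + p.2 ^+ 2 + p.1 ^+ 2 * p.2 ^+ 2 by ring.
  by rewrite lerDl mulr_ge0// sqr_ge0.
- rewrite qE e2 expr2 ler_pM//.
    by apply: Rintegral_ge0 => x _; rewrite mulr_ge0// addr_ge0// sqr_ge0.
  by apply: Rintegral_ge0 => x _; rewrite mulr_ge0// addr_ge0// sqr_ge0.
Qed.

(** * Limits of the masses *)

Section MassLimit.
Hypothesis M_gt0 : 0 < M.
Let root := Num.sqrt (1 + 8 * lambda * M / gamma).
Let m_oo := 2 * M / (1 + root).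

Let root_sqr : root ^+ 2 = 1 + 8 * lambda * M / gamma.
Proof. by rewrite sqr_sqrtr// addr_ge0// divr_ge0 ?mulr_ge0// ltW. Qed.

Let root1_gt0 : 0 < 1 + root.
Proof. by rewrite ltr_pwDl// sqrtr_ge0. Qed.

Lemma m_oo_gt0 : 0 < m_oo.
Proof. by rewrite divr_gt0// mulr_gt0. Qed.

(** This makes [m_oo] stationary for the equation of [Mf] in which [Mg] is
    expressed by the total mass. *)
Let m_oo_eq : 2 * lambda * m_oo ^+ 2 + gamma * m_oo = gamma * M.
Proof.
have g1 : gamma != 0 by rewrite gt_eqF.
have r1 : 1 + root != 0 by rewrite gt_eqF.
have E1 : 8 * lambda * M = gamma * (root ^+ 2 - 1).
  by rewrite root_sqr; field.
have -> : 2 * lambda * m_oo ^+ 2 = 8 * lambda * M * M / (1 + root) ^+ 2.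
  by rewrite /m_oo; field.
by rewrite E1 /m_oo; field.
Qed.

(** With [Mg] expressed by the total mass, the derivative of [Mf - m_oo] is
    [- (gamma + 2 lambda (Mf + m_oo)) (Mf - m_oo)], so the square of [Mf - m_oo]
    decays at least at the rate [2 * gamma]. *)
Lemma Mf_cvg : Mf t @[t --> +oo] --> m_oo.
Proof.
have m0 := m_oo_gt0.
pose y t := (Mf t - m_oo) ^+ 2.
pose y' t := 2 * (Mf t - m_oo) * (2 * gamma * Mg t - 2 * lambda * Mf t ^+ 2).
have cM : cont0 (fun t => Mf t - m_oo) by apply: cont0D cMf _; exact: cont0_cst.
have dy (t : R) : 0 < t -> is_derive t 1 y (y' t).
  move=> t0; have := is_deriveX 2 (is_deriveB (Mf_derive t0) (is_derive_cst m_oo t 1)).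
  by move=> /is_derive_eq; apply; rewrite /y' /GRing.scale/= expr1 subr0.
have yle (t : R) : 0 < t -> y' t <= - (2 * gamma) * y t.
  move=> t0; rewrite -subr_ge0.
  have -> : - (2 * gamma) * y t - y' t = 4 * lambda * (Mf t + m_oo) * y t.
    rewrite /y /y'; have -> : 2 * gamma * Mg t = gamma * M - gamma * Mf t.
      by rewrite -(total_mass (ltW t0)); ring.
    by rewrite -m_oo_eq; ring.
  have l0 := ltW lambda0; have f1 := Mf_ge0 (ltW t0); have m1 := ltW m0.
  apply: mulr_ge0; last exact: sqr_ge0.
  by apply: mulr_ge0; [rewrite mulr_ge0|exact: addr_ge0].
have yb := exponential_bound (lexx 0) (cont0M cM cM) dy yle.
have y0 : y t @[t --> +oo] --> 0.
  apply: (@exponential_cvg0 R y (2 * gamma) (y 0) 0); first exact: mulr_gt0.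
  by move=> t t0; rewrite sqr_ge0/=; exact: yb.
apply/cvgrPdist_lt => e e0.
have e2 : 0 < e ^+ 2 by rewrite exprn_gt0.
move/cvgr0Pnorm_lt : y0 => /(_ _ e2); apply: filterS => t.
rewrite ger0_norm ?sqr_ge0// distrC -[y t]real_normK ?num_real//.
by rewrite ltr_pXn2r// ?nnegrE// ltW.
Qed.

Lemma Mg_cvg : Mg t @[t --> +oo] -->
  2 * M / (1 + root) * ((2 * lambda * M / gamma) / (1 + root)).
Proof.
have -> : 2 * M / (1 + root) * ((2 * lambda * M / gamma) / (1 + root)) =
    (M - m_oo) / 2.
  have g1 : gamma != 0 by rewrite gt_eqF.
  have r1 : 1 + root != 0 by rewrite gt_eqF.
  have ME : M = (2 * lambda * m_oo ^+ 2 + gamma * m_oo) / gamma.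
    by rewrite m_oo_eq; field.
  transitivity (lambda * m_oo ^+ 2 / gamma).
    by rewrite /m_oo; field; rewrite g1 r1.
  by rewrite [in RHS]ME; field.
have : (M - Mf t) / 2 @[t --> +oo] --> (M - m_oo) / 2.
  by apply: cvgM; [apply: cvgB; [exact: cvg_cst|exact: Mf_cvg]|exact: cvg_cst].
apply: cvg_trans; apply: near_eq_cvg; near=> t.
have t0 : 0 <= t by near: t; apply: nbhs_pinfty_ge; rewrite num_real.
by rewrite -(total_mass t0); field.
Unshelve. all: by end_near. Qed.
End MassLimit.

(** * The closed system of moments *)

(** The symmetry of [g0] persists because the flow commutes with the exchange of
    the coordinates and the source [f f_*] is symmetric. *)
Lemma moment_g_swap (w : TRR -> R) (t : R) : measurable_fun setT w ->
  (forall p, 0 <= w p) -> 0 <= t ->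
  (\int[mu2]_p (w (p.2, p.1) * g t p)%:E = \int[mu2]_p (w p * g t p)%:E)%E.
Proof.
move=> mw w0 t0.
have mws : measurable_fun [set: TRR] (fun p => w (p.2, p.1)).
  by apply: measurableT_comp => //; exact: measurable_swap.
have ws0 p : 0 <= w (p.2, p.1) by [].
have weak (w' : TRR -> R) (mw' : measurable_fun setT w') (w'0 : forall p, 0 <= w' p) :=
  weak_g lambda0 mg0 mf mg g0_ge0 f_ge0 g_ge0 gE mw' w'0 t0.
rewrite (weak _ mws ws0) (weak _ mw w0).
have flow_swap (s : R) (p : TRR) :
    ((flow s p).2, (flow s p).1) = flow s (p.2, p.1) :> TRR.
  by rewrite /flow /=; congr (_, _); congr (_ + _); rewrite addrC.
have swap_int (s : R) (h : TRR -> R) : measurable_fun setT h ->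
    (forall p, 0 <= h p) -> (forall p, h (p.2, p.1) = h p) ->
    (\int[mu2]_p (w ((flow s p).2, (flow s p).1) * h p)%:E =
     \int[mu2]_p (w (flow s p) * h p)%:E)%E.
  move=> mh h0 hs.
  rewrite -(@ge0_integral_swap R (fun p => (w (flow s p) * h p)%:E)).
  - by apply: eq_integral => p _; rewrite hs flow_swap.
  - apply/measurable_EFinP; apply: measurable_funM => //.
    by apply: measurableT_comp => //; exact: measurable_flow.
  - by move=> p; rewrite lee_fin mulr_ge0.
have g0s p : g0 (p.2, p.1) = g0 p by case: p => x y; rewrite g0_sym.
have -> : (\int[mu2]_p (w ((flow t p).2, (flow t p).1) * g0 p)%:E =
    \int[mu2]_p (w (flow t p) * g0 p)%:E)%E by exact: swap_int.
suff E1 : (\int[mu]_(s in `[0%R, t]) ((expR (- (gamma * (t - s))))%:E *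
    \int[mu2]_p (w ((flow (t - s) p).2, (flow (t - s) p).1) *
      (f s p.1 * f s p.2))%:E) =
  \int[mu]_(s in `[0%R, t]) ((expR (- (gamma * (t - s))))%:E *
    \int[mu2]_p (w (flow (t - s) p) * (f s p.1 * f s p.2))%:E))%E.
  by rewrite E1; reflexivity.
apply: eq_integral => s _; congr (_ * _)%E; apply: swap_int.
- by apply: measurable_funM; exact: measurableT_comp.
- by move=> p; rewrite mulr_ge0.
- by move=> p; rewrite mulrC.
Qed.

Let qc (c x : R) := (x - c) ^+ 2.
Let am (c : R) (p : TRR) := ((p.1 + p.2) / 2 - c) ^+ 2.
Let dd (p : TRR) := ((p.1 - p.2) / 2) ^+ 2.

Let V (c t : R) := \int[mu]_x (qc c x * f t x).
Let Am (c t : R) := \int[mu2]_p (am c p * g t p).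
Let Dd (t : R) := \int[mu2]_p (dd p * g t p).
Let P (c t : R) := \int[mu]_x ((x - c) * f t x).
Let G (c t : R) := \int[mu2]_p (((p.1 + p.2) / 2 - c) * g t p).

Let mqc c : measurable_fun [set: TR] (qc c).
Proof. by apply: measurable_funX; exact: measurable_funB. Qed.

Let mmean : measurable_fun [set: TRR] (fun p => (p.1 + p.2) / 2).
Proof. by apply: measurable_funM => //; exact: measurable_funD. Qed.

Let mam c : measurable_fun [set: TRR] (am c).
Proof. by apply: measurable_funX; exact: measurable_funB. Qed.

Let mdd : measurable_fun [set: TRR] dd.
Proof.
by apply: measurable_funX; apply: measurable_funM => //; exact: measurable_funB.
Qed.

Let K (c : R) := 2 * (1 + c ^+ 2).

Let K_ge0 c : 0 <= K c.
Proof. by rewrite mulr_ge0// addr_ge0// sqr_ge0. Qed.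

Let qc_le c x : `|qc c x| <= K c * (1 + x ^+ 2).
Proof.
rewrite ger0_norm ?sqr_ge0// -subr_ge0.
have -> : K c * (1 + x ^+ 2) - qc c x = 2 + (x + c) ^+ 2 + 2 * (c * x) ^+ 2.
  by rewrite /K /qc; ring.
by repeat (apply: sqr_ge0 || apply: addr_ge0 || apply: mulr_ge0).
Qed.

Let am_le c p : `|am c p| <= K c * (1 + p.1 ^+ 2 + p.2 ^+ 2).
Proof.
rewrite ger0_norm ?sqr_ge0// -subr_ge0.
have -> : K c * (1 + p.1 ^+ 2 + p.2 ^+ 2) - am c p =
    2 + 2 * ((c * p.1) ^+ 2 + (c * p.2) ^+ 2) + p.1 ^+ 2 + p.2 ^+ 2 +
    ((p.1 + p.2) / 2 + c) ^+ 2 + 2 * ((p.1 - p.2) / 2) ^+ 2.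
  by rewrite /K /am; field.
by repeat (apply: sqr_ge0 || apply: addr_ge0 || apply: mulr_ge0).
Qed.

Let dd_le p : `|dd p| <= 1 * (1 + p.1 ^+ 2 + p.2 ^+ 2).
Proof.
rewrite ger0_norm ?sqr_ge0// -subr_ge0.
have -> : 1 * (1 + p.1 ^+ 2 + p.2 ^+ 2) - dd p =
    1 + 2 * ((p.1 + p.2) / 2) ^+ 2 + ((p.1 - p.2) / 2) ^+ 2.
  by rewrite /dd; field.
by repeat (apply: sqr_ge0 || apply: addr_ge0 || apply: mulr_ge0).
Qed.

Let qc_fst_le c (p : TRR) : `|qc c p.1| <= K c * (1 + p.1 ^+ 2 + p.2 ^+ 2).
Proof.
by apply: (le_trans (qc_le c p.1)); rewrite ler_wpM2l// lerDl sqr_ge0.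
Qed.

Let am_flow c (t : R) p : am c (flow t p) = expR (- (0 * t)) * am c p.
Proof. by rewrite mul0r oppr0 expR0 /am /flow /=; field. Qed.

Let dd_flow (t : R) p : dd (flow t p) = expR (- (2 * t)) * dd p.
Proof.
have -> : - (2 * t) = - t + - t by ring.
by rewrite expRD /dd /flow /=; field.
Qed.

(** By symmetry both coordinates have the same moment, and
    [(x - c)^2 + (y - c)^2] is twice [am c + dd] at [(x, y)]. *)
Let qc_fst c (t : R) : 0 <= t ->
  \int[mu2]_p (qc c p.1 * g t p) = Am c t + Dd t.
Proof.
move=> t0.
have mq1 : measurable_fun [set: TRR] (fun p => qc c p.1) by exact: measurableT_comp.
have mq2 : measurable_fun [set: TRR] (fun p => qc c p.2) by exact: measurableT_comp.
have q0 (p : TRR) : 0 <= qc c p.1 by exact: sqr_ge0.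
have [i1 _] := g_quadratic mq1 (K_ge0 c) (qc_fst_le c) t0.
have qc_snd_le (p : TRR) : `|qc c p.2| <= K c * (1 + p.1 ^+ 2 + p.2 ^+ 2).
  apply: (le_trans (qc_le c p.2)); rewrite ler_wpM2l// -addrA lerD2l lerDr.
  exact: sqr_ge0.
have [i2 _] := g_quadratic mq2 (K_ge0 c) qc_snd_le t0.
have [ia _] := g_quadratic (mam c) (K_ge0 c) (am_le c) t0.
have [id _] := g_quadratic mdd ler01 dd_le t0.
have E12 : \int[mu2]_p (qc c p.2 * g t p) = \int[mu2]_p (qc c p.1 * g t p).
  by rewrite /Rintegral (moment_g_swap mq1 q0 t0).
have E2 : \int[mu2]_p (qc c p.1 * g t p) + \int[mu2]_p (qc c p.2 * g t p) =
    2 * (Am c t + Dd t).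
  rewrite -RintegralD// /Am /Dd -RintegralD// -RintegralZl//; last exact: intbleD.
  by apply: eq_Rintegral => p _; rewrite /qc /am /dd; field.
apply: (@mulfI _ 2); first by rewrite pnatr_eq0.
by rewrite -E2 E12 mulr_natl mulr2n.
Qed.

Let linear_f c (t : R) : 0 <= t -> intble1 (fun x => (x - c) * f t x).
Proof.
move=> t0.
have [i1 _] := f_quadratic (mqc (c - 1)) (K_ge0 _) (qc_le (c - 1)) t0.
have [i2 _] := f_quadratic (mqc (c + 1)) (K_ge0 _) (qc_le (c + 1)) t0.
apply: eq_integrable (intbleZ 4^-1 (intbleB i1 i2)) => // x _ /=.
by rewrite /qc; congr (_%:E); field.
Qed.

(** The squares of the mean and of the half-difference expand into the same
    squares and opposite cross terms of the coordinates relative to [c]; the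
    integral of the latter against the product density is a multiple of [P ^ 2]. *)
Let ff_moments c (t : R) : 0 <= t ->
  [/\ intble2 (fun p => am c p * (f t p.1 * f t p.2)),
      intble2 (fun p => dd p * (f t p.1 * f t p.2)),
      \int[mu2]_p (am c p * (f t p.1 * f t p.2)) =
        (V c t * Mf t + P c t ^+ 2) / 2
    & \int[mu2]_p (dd p * (f t p.1 * f t p.2)) =
        (V c t * Mf t - P c t ^+ 2) / 2].
Proof.
move=> t0.
have [ia _] := ff_quadratic (mam c) (K_ge0 c) (am_le c) t0.
have [id _] := ff_quadratic mdd ler01 dd_le t0.
have [iq _] := f_quadratic (mqc c) (K_ge0 c) (qc_le c) t0.
have i1 := linear_f c t0.
have [j1 e1] := integrable_tensor iq (f_int t0).
have [j2 e2] := integrable_tensor (f_int t0) iq.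
have [j3 e3] := integrable_tensor i1 i1.
have j12 := intbleD j1 j2; have j3' := intbleZ 2 j3.
have e12 : \int[mu2]_p (qc c p.1 * f t p.1 * f t p.2 +
    f t p.1 * (qc c p.2 * f t p.2)) = 2 * (V c t * Mf t).
  by rewrite RintegralD// e1 e2 -/(V c t) -/(nf t) (massesE t0).1; ring.
split => //.
- transitivity (\int[mu2]_p (4^-1 * ((qc c p.1 * f t p.1 * f t p.2 +
      f t p.1 * (qc c p.2 * f t p.2)) + 2 * ((p.1 - c) * f t p.1 * ((p.2 - c) * f t p.2))))).
    by apply: eq_Rintegral => p _; rewrite /qc /am; field.
  rewrite RintegralZl//; last exact: intbleD j12 j3'.
  by rewrite RintegralD// e12 RintegralZl// e3 -/(P c t); field.
- transitivity (\int[mu2]_p (4^-1 * ((qc c p.1 * f t p.1 * f t p.2 +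
      f t p.1 * (qc c p.2 * f t p.2)) - 2 * ((p.1 - c) * f t p.1 * ((p.2 - c) * f t p.2))))).
    by apply: eq_Rintegral => p _; rewrite /qc /dd; field.
  rewrite RintegralZl//; last exact: intbleB j12 j3'.
  by rewrite RintegralB// e12 RintegralZl// e3 -/(P c t); field.
Qed.

Let integrable_segmentZ (k T : R) (b : R -> R) :
  mu.-integrable `[0, T] (EFin \o b) ->
  mu.-integrable `[0, T] (EFin \o (fun s => k * b s)).
Proof.
have mI : measurable (`[0%R, T] : set TR) by exact: measurable_itv.
by move=> ib; have := integrableZl mI k ib.
Qed.

Let V_duhamel c (t : R) : 0 <= t -> V c t =
  duhamel A (\int[mu]_x (qc c x * f0 x)) (fun s => 2 * gamma * (Am c s + Dd s)) t.
Proof.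
move=> t0.
have mq1 : measurable_fun [set: TRR] (fun p => qc c p.1) by exact: measurableT_comp.
rewrite -(@eq_duhamel R A _
  (fun s => 2 * gamma * \int[mu2]_p (qc c p.1 * g s p))); last first.
  by move=> s s0; rewrite qc_fst.
apply: moment_f_duhamel t0 => //.
- by move=> x; exact: sqr_ge0.
- exact: (f0_quadratic (mqc c) (qc_le c)).
- by move=> s s0; have [] := f_quadratic (mqc c) (K_ge0 c) (qc_le c) s0.
- by move=> s s0; have [] := g_quadratic mq1 (K_ge0 c) (qc_fst_le c) s0.
move=> T; apply: (@bounded_integrable_segment R _ T (K c * (M + 2 * E T))).
  by apply: (measurable_moment_g mq1) => p; exact: sqr_ge0.
move=> s /andP[s0 sT].
have [_ /le_trans] := g_quadratic mq1 (K_ge0 c) (qc_fst_le c) s0; apply.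
by rewrite ler_wpM2l// lerD2l ler_wpM2l// E_mono.
Qed.

Let measurable_ff (w : TRR -> R) : measurable_fun setT w -> (forall p, 0 <= w p) ->
  measurable_fun [set: TR] (fun s => \int[mu2]_p (w p * (f s p.1 * f s p.2))).
Proof.
move=> mw w0; apply: (measurableT_comp (fine_measurable measurableT)).
apply: (@measurable_moment_ff (fun _ p => w p)) => //.
exact: measurableT_comp.
Qed.

Let ff_segment (w : TRR -> R) (k T : R) : measurable_fun setT w ->
  (forall p, 0 <= w p) -> 0 <= k ->
  (forall p, `|w p| <= k * (1 + p.1 ^+ 2 + p.2 ^+ 2)) ->
  mu.-integrable `[0, T]
    (EFin \o (fun s => \int[mu2]_p (w p * (f s p.1 * f s p.2)))).
Proof.
move=> mw w0 k0 wk.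
apply: (@bounded_integrable_segment R _ T (k * (M + E T) ^+ 2)).
  exact: measurable_ff.
move=> s /andP[s0 sT].
have [_ /le_trans] := ff_quadratic mw k0 wk s0; apply.
have ME (x : R) : 0 <= M + E x by exact: addr_ge0.
by rewrite ler_wpM2l// ler_pXn2r ?nnegrE// lerD2l E_mono.
Qed.

Let Am_duhamel c (t : R) : 0 <= t -> Am c t =
  duhamel (fun t => (gamma + 0) * t) (\int[mu2]_p (am c p * g0 p))
    (fun s => lambda * \int[mu2]_p (am c p * (f s p.1 * f s p.2))) t.
Proof.
move=> t0; apply: moment_g_duhamel t0 => //.
- by move=> p; exact: sqr_ge0.
- exact: (g0_quadratic (mam c) (am_le c)).
- by move=> s s0; have [] := g_quadratic (mam c) (K_ge0 c) (am_le c) s0.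
- by move=> s s0; have [] := ff_moments c s0.
- by move=> T; apply: (ff_segment T (mam c) _ (K_ge0 c) (am_le c)) => p; exact: sqr_ge0.
Qed.

Let Dd_duhamel (t : R) : 0 <= t -> Dd t =
  duhamel (fun t => (gamma + 2) * t) (\int[mu2]_p (dd p * g0 p))
    (fun s => lambda * \int[mu2]_p (dd p * (f s p.1 * f s p.2))) t.
Proof.
move=> t0; apply: moment_g_duhamel t0 => //.
- by move=> p; exact: sqr_ge0.
- exact: (g0_quadratic mdd dd_le).
- by move=> s s0; have [] := g_quadratic mdd ler01 dd_le s0.
- by move=> s s0; have [] := ff_moments 0 s0.
- by move=> T; apply: (ff_segment T mdd _ ler01 dd_le) => p; exact: sqr_ge0.
Qed.

Let cAm c : cont0 (Am c).
Proof.
apply: duhamel_eq_continuous (@cont0_scale R (gamma + 0)) _ (Am_duhamel c) => T.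
apply: integrable_segmentZ.
by apply: (ff_segment T (mam c) _ (K_ge0 c) (am_le c)) => p; exact: sqr_ge0.
Qed.

Let cDd : cont0 Dd.
Proof.
apply: duhamel_eq_continuous (@cont0_scale R (gamma + 2)) _ Dd_duhamel => T.
apply: integrable_segmentZ.
by apply: (ff_segment T mdd _ ler01 dd_le) => p; exact: sqr_ge0.
Qed.

Let cAD c : cont0 (fun s => 2 * gamma * (Am c s + Dd s)).
Proof. by apply: cont0M; [exact: cont0_cst|exact: cont0D]. Qed.

Let cV c : cont0 (V c).
Proof.
apply: duhamel_eq_continuous cA _ (V_duhamel c) => T.
exact: continuous0_integrable.
Qed.

(** First moments are recovered from second moments about two centres, so that
    their evolution follows from that of the latter by polarization. *)
Let P_polar c (t : R) : 0 <= t -> P c t = (V (c - 1) t - V (c + 1) t) / 4.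
Proof.
move=> t0.
have [i1 _] := f_quadratic (mqc (c - 1)) (K_ge0 _) (qc_le (c - 1)) t0.
have [i2 _] := f_quadratic (mqc (c + 1)) (K_ge0 _) (qc_le (c + 1)) t0.
rewrite /V -RintegralB// mulrC -RintegralZl//; last exact: intbleB.
by apply: eq_Rintegral => x _; rewrite /qc; field.
Qed.

Let G_polar c (t : R) : 0 <= t -> G c t = (Am (c - 1) t - Am (c + 1) t) / 4.
Proof.
move=> t0.
have [i1 _] := g_quadratic (mam (c - 1)) (K_ge0 _) (am_le (c - 1)) t0.
have [i2 _] := g_quadratic (mam (c + 1)) (K_ge0 _) (am_le (c + 1)) t0.
rewrite /Am -RintegralB// mulrC -RintegralZl//; last exact: intbleB.
by apply: eq_Rintegral => x _; rewrite /am; field.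
Qed.

Let P_shift c h (t : R) : 0 <= t -> P (c + h) t = P c t - h * Mf t.
Proof.
move=> t0; have ic := linear_f c t0; have ih := intbleZ h (f_int t0).
rewrite -(massesE t0).1 -[h * nf t]RintegralZl//; last exact: f_int.
rewrite -RintegralB//; apply: eq_Rintegral => x _; ring.
Qed.

Let cP c : cont0 (P c).
Proof.
apply: (@cont0_eq R (fun t => (V (c - 1) t - V (c + 1) t) / 4)).
  by move=> t t0; rewrite P_polar.
by apply: cont0M; [exact: (cont0D (@cV (c - 1)) (cont0N (@cV (c + 1))))|exact: cont0_cst].
Qed.

Let cG c : cont0 (G c).
Proof.
apply: (@cont0_eq R (fun t => (Am (c - 1) t - Am (c + 1) t) / 4)).
  by move=> t t0; rewrite G_polar.
by apply: cont0M; [exact: (cont0D (@cAm (c - 1)) (cont0N (@cAm (c + 1))))|exact: cont0_cst].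
Qed.

Let V_derive c (t : R) : 0 < t ->
  is_derive t 1 (V c) (- (2 * lambda * Mf t) * V c t + 2 * gamma * (Am c t + Dd t)).
Proof. exact: (duhamel_eq_derive cA dA (@cAD c) (V_duhamel c)). Qed.

Let cVM c (e : R) : cont0 (fun s => lambda * ((V c s * Mf s + e * P c s ^+ 2) / 2)).
Proof.
apply: cont0M; first exact: cont0_cst.
apply: cont0M; last exact: cont0_cst.
apply: cont0D; first exact: (cont0M (@cV c) cMf).
by apply: cont0M; [exact: cont0_cst|exact: (cont0M (@cP c) (@cP c))].
Qed.

Let Am_derive c (t : R) : 0 < t -> is_derive t 1 (Am c)
  (- gamma * Am c t + lambda * ((V c t * Mf t + P c t ^+ 2) / 2)).
Proof.
move=> t0; rewrite -[gamma]addr0 -[P c t ^+ 2]mul1r.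
apply: (duhamel_eq_derive (a := fun=> gamma + 0) (@cont0_scale R (gamma + 0)) _
  (@cVM c 1) _ t0).
- by move=> s _; exact: is_derive_scale.
- move=> s s0; rewrite Am_duhamel//; apply: eq_duhamel => r r0.
  by have [_ _ -> _] := ff_moments c r0; rewrite mul1r.
Qed.

Let Dd_derive c (t : R) : 0 < t -> is_derive t 1 Dd
  (- (gamma + 2) * Dd t + lambda * ((V c t * Mf t - P c t ^+ 2) / 2)).
Proof.
move=> t0; rewrite -[- P c t ^+ 2]mulN1r.
apply: (duhamel_eq_derive (a := fun=> gamma + 2) (@cont0_scale R (gamma + 2)) _
  (@cVM c (-1)) _ t0).
- by move=> s _; exact: is_derive_scale.
- move=> s s0; rewrite Dd_duhamel//; apply: eq_duhamel => r r0.
  by have [_ _ _ ->] := ff_moments c r0; rewrite mulN1r.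
Qed.

Let polar_derive (u1 u2 u : R -> R) (t d1 d2 d : R) : 0 < t ->
  (forall s : R, 0 <= s -> u s = (u1 s - u2 s) / 4) ->
  is_derive t 1 u1 d1 -> is_derive t 1 u2 d2 -> d = (d1 - d2) / 4 ->
  is_derive t 1 u d.
Proof.
move=> t0 uE du1 du2 ->.
apply: (@near_eq_is_derive _ _ _ (fun s => 4^-1 * (u1 s - u2 s))).
  near=> s; rewrite uE; first by rewrite mulrC.
  by apply: ltW; near: s; exact: lt_nbhsr.
have := is_deriveZ 4^-1 (is_deriveB du1 du2).
by move=> /is_derive_eq; apply; rewrite /GRing.scale/= mulrC.
Unshelve. all: by end_near. Qed.

Let P_derive c (t : R) : 0 < t ->
  is_derive t 1 (P c) (- (2 * lambda * Mf t) * P c t + 2 * gamma * G c t).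
Proof.
move=> t0; have t0' := ltW t0.
apply: (polar_derive t0 (P_polar c) (V_derive (c - 1) t0) (V_derive (c + 1) t0)).
by rewrite P_polar// G_polar//; field.
Qed.

Let G_derive c (t : R) : 0 < t ->
  is_derive t 1 (G c) (- gamma * G c t + lambda * (Mf t * P c t)).
Proof.
move=> t0; have t0' := ltW t0.
apply: (polar_derive t0 (G_polar c) (Am_derive (c - 1) t0) (Am_derive (c + 1) t0)).
rewrite G_polar// (P_shift c (-1) t0') (P_shift c 1 t0').
have -> : V (c - 1) t = 4 * P c t + V (c + 1) t by rewrite P_polar//; field.
by field.
Qed.

(** * Concentration at the barycentre *)

Section Concentration.
Hypothesis M_gt0 : 0 < M.
Let root := Num.sqrt (1 + 8 * lambda * M / gamma).
Let m_oo := 2 * M / (1 + root).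
Let c := (\int[mu]_x (x * f0 x) + 2 * \int[mu2]_p (p.1 * g0 p)) / M.

Let f_initial : {ae mu, forall x, f 0 x = f0 x}.
Proof.
have := fE (lexx 0); apply: filterS => x.
rewrite set_itv1 integral_set1 mule0 adde0.
by rewrite [A 0](cumulated_rate_le0 lambda Mf (lexx 0)) oppr0 expR0 mul1r => -[].
Qed.

Let g_initial : {ae mu2, forall p, g 0 p = g0 p}.
Proof.
have := gE (lexx 0); apply: filterS => -[x y].
rewrite set_itv1 integral_set1 mule0 adde0 => -[->].
rewrite /semigroup mulr0 expR0 mul1r /flow /= !oppr0 expR0 !mul1r.
by congr (g0 (_, _)); field.
Qed.

(** The barycentre of the total mass is conserved, and [c] is its value. *)
Let P_G (t : R) : 0 <= t -> P c t + 2 * G c t = 0.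
Proof.
move=> t0; pose u s := P c s + 2 * G c s.
have cu : cont0 u.
  by apply: cont0D (@cP c) _; apply: cont0M (@cG c); exact: cont0_cst.
have du (s : R) : 0 < s -> is_derive s 1 u 0.
  move=> s0; have := is_deriveD (P_derive c s0) (is_deriveZ 2 (G_derive c s0)).
  by move=> /is_derive_eq; apply; rewrite /GRing.scale/=; ring.
have -> : P c t + 2 * G c t = u 0 := constant_halfline cu du t0.
have x_f0 : intble1 (fun x => x * f0 x).
  apply: (@f0_quadratic (fun x => x) 1) => // x; rewrite mul1r.
  have := sqr_ge0 (`|x| - 1); rewrite -[x ^+ 2]real_normK ?num_real//.
  have := normr_ge0 x; set a := `|x|; nra.
have x_g0 : intble2 (fun p => p.1 * g0 p).
  apply: (@g0_quadratic fst 1) => // p; rewrite mul1r.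
  have := sqr_ge0 (`|p.1| - 1); rewrite -[p.1 ^+ 2]real_normK ?num_real//.
  have := sqr_ge0 p.2; have := normr_ge0 p.1; set a := `|p.1|; nra.
have P0 : P c 0 = \int[mu]_x (x * f0 x) - c * Mf 0.
  transitivity (\int[mu]_x ((x - c) * f0 x)).
    apply: ae_eq_Rintegral.
    - by apply: measurable_funM => //; exact: measurable_funB.
    - by apply: measurable_funM => //; exact: measurable_funB.
    - by apply: filterS f_initial => x ->.
  rewrite Mf0 -RintegralZl// -RintegralB//; last exact: intbleZ.
  by apply: eq_Rintegral => x _; ring.
have mq (e : R) : measurable_fun [set: TRR] (fun p => qc e p.1) by exact: measurableT_comp.
have G0 : G c 0 = \int[mu2]_p (p.1 * g0 p) - c * Mg 0.
  transitivity ((\int[mu2]_p (qc (c - 1) p.1 * g 0 p) -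
      \int[mu2]_p (qc (c + 1) p.1 * g 0 p)) / 4).
    by rewrite G_polar// !qc_fst//; field.
  have [i1 _] := g_quadratic (mq (c - 1)) (K_ge0 _) (qc_fst_le _) (lexx 0).
  have [i2 _] := g_quadratic (mq (c + 1)) (K_ge0 _) (qc_fst_le _) (lexx 0).
  transitivity (\int[mu2]_p ((p.1 - c) * g0 p)).
    rewrite -RintegralB// mulrC -RintegralZl//; last exact: intbleB.
    apply: ae_eq_Rintegral.
    - apply: measurable_funM => //.
      by apply: measurable_funB; apply: measurable_funM.
    - by apply: measurable_funM => //; exact: measurable_funB.
    - by apply: filterS g_initial => p ->; rewrite /qc; field.
  rewrite Mg0 -RintegralZl// -RintegralB//; last exact: intbleZ.
  by apply: eq_Rintegral => p _; ring.
rewrite /u P0 G0.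
have -> : \int[mu]_x (x * f0 x) - c * Mf 0 + 2 * (\int[mu2]_p (p.1 * g0 p) - c * Mg 0) =
  \int[mu]_x (x * f0 x) + 2 * \int[mu2]_p (p.1 * g0 p) - c * M by rewrite /M; ring.
by rewrite /c divfK ?subrr// gt_eqF.
Qed.

(** With [ep = 1 / (gamma + 2)], the Lyapunov function is
    [V + al * Am + be * Dd + ka * P ^ 2]. In its derivative the coefficient of [V]
    is negative since [al + be < 4], that of [Am] since [al > 2], and that of [Dd]
    since [be > 2 * gamma / (gamma + 2)]. What remains is a multiple of [P ^ 2]:
    this quantity decays by itself, as [G = - P / 2], and [ka] is large enough for
    its decay to absorb the remainder. *)
Lemma second_moment_cvg0 :
  V c t @[t --> +oo] --> 0 /\ Am c t + Dd t @[t --> +oo] --> 0.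
Proof.
have m0 : 0 < m_oo := m_oo_gt0 M_gt0.
have l0 := ltW lambda0; have g0' := ltW gamma0.
pose ep := (gamma + 2)^-1.
have ep0 : 0 < ep by rewrite invr_gt0 addr_gt0.
pose al := 2 + ep; pose be := 2 - 2 * ep; pose ka := 3 * ep * lambda / (2 * gamma).
have al2 : 2 <= al by rewrite lerDl ltW.
have be1 : 1 <= be.
  rewrite /be -subr_ge0; have -> : 2 - 2 * ep - 1 = gamma * ep.
    by rewrite /ep; field; rewrite gt_eqF// addr_gt0.
  by rewrite mulr_ge0// ltW.
have ka0 : 0 <= ka by rewrite divr_ge0 ?mulr_ge0// ltW.
pose W t := V c t + al * Am c t + be * Dd t + ka * P c t ^+ 2.
pose W' t := (- (2 * lambda * Mf t) * V c t + 2 * gamma * (Am c t + Dd t))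
  + al * (- gamma * Am c t + lambda * ((V c t * Mf t + P c t ^+ 2) / 2))
  + be * (- (gamma + 2) * Dd t + lambda * ((V c t * Mf t - P c t ^+ 2) / 2))
  + ka * (2 * P c t * (- (2 * lambda * Mf t) * P c t + 2 * gamma * G c t)).
have cW : cont0 W.
  apply: cont0D; first apply: cont0D; first apply: cont0D => //.
  - by apply: cont0M (@cAm c); exact: cont0_cst.
  - by apply: cont0M cDd; exact: cont0_cst.
  - by apply: cont0M (cont0M (@cP c) (@cP c)); exact: cont0_cst.
have dW (t : R) : 0 < t -> is_derive t 1 W (W' t).
  move=> t0.
  have := is_deriveD (is_deriveD (is_deriveD (V_derive c t0)
    (is_deriveZ al (Am_derive c t0))) (is_deriveZ be (Dd_derive c t0)))
    (is_deriveZ ka (is_deriveX 2 (P_derive c t0))).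
  by move=> /is_derive_eq; apply; rewrite /GRing.scale/= expr1 /W'; ring.
have V0 t : 0 <= V c t by apply: Rintegral_ge0 => x _; rewrite mulr_ge0// sqr_ge0.
have A0 t : 0 <= Am c t by apply: Rintegral_ge0 => x _; rewrite mulr_ge0// sqr_ge0.
have D0 t : 0 <= Dd t by apply: Rintegral_ge0 => x _; rewrite mulr_ge0// sqr_ge0.
have kP0 t : 0 <= ka * P c t ^+ 2 by rewrite mulr_ge0// sqr_ge0.
(* Once [Mf] is at least [m_oo / 2], each of the four terms of [W] is damped at
   least at the rate [c0]. *)
pose c0 := Num.min (Num.min (ep * lambda * m_oo / 4) (ep * gamma / al))
  (Num.min (2 / be) gamma).
have c0_gt0 : 0 < c0.
  have be0 : 0 < be by exact: lt_le_trans be1.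
  have al0 : 0 < al by exact: lt_le_trans al2.
  rewrite !lt_min gamma0 andbT -andbA; apply/and3P; split; apply: divr_gt0 => //.
    by apply: mulr_gt0 => //; apply: mulr_gt0.
  exact: mulr_gt0.
have c0V : c0 <= ep * lambda * m_oo / 4 by rewrite !ge_min lexx.
have c0A : c0 * al <= ep * gamma.
  rewrite -ler_pdivlMr; last by exact: lt_le_trans al2.
  by rewrite !ge_min lexx !orbT.
have c0D : c0 * be <= 2.
  rewrite -ler_pdivlMr; last by exact: lt_le_trans be1.
  by rewrite !ge_min lexx !orbT.
have c0P : c0 <= gamma by rewrite !ge_min lexx !orbT.
have [T T0 MfT] : exists2 T : R, 0 <= T & forall t, T < t -> m_oo / 2 <= Mf t.
  have m2 : m_oo / 2 < m_oo by lra.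
  have /(_ _)[T [_ TP]] := cvgr_ge _ (Mf_cvg M_gt0) _ m2.
  exists (Num.max 0 T); first by rewrite le_max lexx.
  by move=> t; rewrite gt_max => /andP[_]; exact: TP.
have W'le (t : R) : T < t -> W' t <= - c0 * W t.
  move=> Tt; have t0 := le_trans T0 (ltW Tt).
  have mt := MfT _ Tt.
  have PG : G c t = - (P c t) / 2.
    by have := P_G t0; move=> /eqP; rewrite addr_eq0 => /eqP ->; field.
  rewrite -subr_ge0.
  have -> : - c0 * W t - W' t = (ep * lambda * Mf t / 2 - c0) * V c t +
      (ep * gamma - c0 * al) * Am c t + (2 - c0 * be) * Dd t +
      (gamma - c0 + 4 * lambda * Mf t) * (ka * P c t ^+ 2).
    rewrite /W /W' PG /al /be /ka /ep; field.
    by rewrite !gt_eqF// addr_gt0.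
  have f1 := Mf_ge0 t0.
  apply: addr_ge0; first apply: addr_ge0; first apply: addr_ge0.
  - apply: mulr_ge0 => //; rewrite subr_ge0 (le_trans c0V)//.
    have -> : ep * lambda * m_oo / 4 = ep * lambda / 2 * (m_oo / 2) by field.
    have -> : ep * lambda * Mf t / 2 = ep * lambda / 2 * Mf t by field.
    by rewrite ler_wpM2l// divr_ge0// mulr_ge0// ltW.
  - by apply: mulr_ge0 => //; rewrite subr_ge0.
  - by apply: mulr_ge0 => //; rewrite subr_ge0.
  - by apply: mulr_ge0 => //; rewrite addr_ge0 ?subr_ge0// !mulr_ge0.
have Wb := exponential_bound T0 cW dW W'le.
split; apply: (exponential_cvg0 c0_gt0) => t Tt; apply/andP; split => //.
- apply: (le_trans _ (Wb t Tt)); rewrite /W -!addrA lerDl.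
  by rewrite addr_ge0 ?addr_ge0// mulr_ge0// (le_trans _ be1, le_trans _ al2).
- exact: addr_ge0.
- apply: (le_trans _ (Wb t Tt)); rewrite /W.
  have A1 : Am c t <= al * Am c t by rewrite ler_peMl// (le_trans _ al2)// ler1n.
  have D1 : Dd t <= be * Dd t by rewrite ler_peMl.
  apply: (le_trans (lerD A1 D1)); rewrite -subr_ge0.
  have -> : V c t + al * Am c t + be * Dd t + ka * P c t ^+ 2 -
    (al * Am c t + be * Dd t) = V c t + ka * P c t ^+ 2 by ring.
  exact: addr_ge0.
Qed.

Lemma f_concentrates (psi : R -> R) (B : R) : continuous psi ->
  (forall x, `|psi x| <= B) ->
  \int[mu]_x (f t x * psi x) @[t --> +oo] --> m_oo * psi c.
Proof.
move=> cpsi psiB.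
apply: (@concentration_cvg _ _ _ mu f (qc c) psi (psi c) m_oo B) => //.
- move=> t t0; exact: (f_quadratic (mqc c) (K_ge0 c) (qc_le c) t0).1.
- exact: continuous_measurable_fun.
- move=> e e0.
  have [C C0 CP] := continuous_quadratic_modulus (cpsi c) psiB e0.
  by exists C => // x; rewrite /qc -[(x - c) ^+ 2]real_normK ?num_real//; exact: CP.
- apply: cvg_trans (Mf_cvg M_gt0); apply: near_eq_cvg; near=> t.
  have t0 : 0 <= t by near: t; apply: nbhs_pinfty_ge; rewrite num_real.
  by have [<-] := massesE t0.
- exact: second_moment_cvg0.1.
Unshelve. all: by end_near. Qed.

Lemma g_concentrates (psi : R * R -> R) (B : R) : continuous psi ->
  (forall p, `|psi p| <= B) ->
  \int[mu2]_p (g t p * psi p) @[t --> +oo] -->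
    2 * M / (1 + root) * ((2 * lambda * M / gamma) / (1 + root)) * psi (c, c).
Proof.
move=> cpsi psiB.
have iam (t : R) (t0 : 0 <= t) := (g_quadratic (mam c) (K_ge0 c) (am_le c) t0).1.
have idd (t : R) (t0 : 0 <= t) := (g_quadratic mdd ler01 dd_le t0).1.
apply: (@concentration_cvg _ _ _ mu2 g (fun p => am c p + dd p) psi _ _ B) => //.
- move=> t t0; apply: eq_integrable (intbleD (iam t t0) (idd t t0)) => //.
  by move=> p _ /=; rewrite mulrDl.
- exact: continuous_measurable_plane.
- move=> e e0.
  have [C C0 CP] := continuous_quadratic_modulus (cpsi (c, c)) psiB e0.
  exists (C * 2); first exact: mulr_ge0.
  move=> -[x y]; apply: (le_trans (CP (x, y))).
  rewrite lerD2l -mulrA ler_wpM2l//.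
  (* [(x - c)^2 + (y - c)^2] is twice [am c + dd] at [(x, y)], and one of its two
     terms is the square of the maximum norm. *)
  have /orP[] : (`|(x, y) - (c, c)| == `|x - c|) || (`|(x, y) - (c, c)| == `|y - c|).
    by rewrite prod_normE /=; case: leP => _; rewrite eqxx ?orbT.
  - move=> /eqP ->; rewrite real_normK ?num_real// -subr_ge0.
    have -> : 2 * (am c (x, y) + dd (x, y)) - (x - c) ^+ 2 = (y - c) ^+ 2.
      by rewrite /am /dd/=; field.
    exact: sqr_ge0.
  - move=> /eqP ->; rewrite real_normK ?num_real// -subr_ge0.
    have -> : 2 * (am c (x, y) + dd (x, y)) - (y - c) ^+ 2 = (x - c) ^+ 2.
      by rewrite /am /dd/=; field.
    exact: sqr_ge0.
- apply: cvg_trans (Mg_cvg M_gt0); apply: near_eq_cvg; near=> t.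
  have t0 : 0 <= t by near: t; apply: nbhs_pinfty_ge; rewrite num_real.
  by have [_ <-] := massesE t0.
- apply: cvg_trans second_moment_cvg0.2; apply: near_eq_cvg; near=> t.
  have t0 : 0 <= t by near: t; apply: nbhs_pinfty_ge; rewrite num_real.
  rewrite /Am /Dd -RintegralD//; [|exact: iam|exact: idd].
  by apply: eq_Rintegral => p _; rewrite mulrDl.
Unshelve. all: by end_near. Qed.
End Concentration.
End Moments.

(** * The limit of the solution *)

Section RepresentativeMoments.
Context (R : realType) d (T : measurableType d) (m : {measure set T -> \bar R}).
Local Notation TR := (measurableTypeR R).
Variable h : R -> T -> R.
Hypotheses (ch : continuous_L1_plus m h)
  (mh : measurable_fun ((`[0%R, +oo[ : set TR) `*` setT)
    (fun q : TR * T => h q.1 q.2)).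

Let ih (t : R) : 0 <= t -> m.-integrable setT (EFin \o h t).
Proof. by case: ch => + _ _ => /[apply]/Lfun1_integrable. Qed.

Let mpos (t : R) : measurable_fun setT (pos_rep h t).
Proof. exact: (measurable_fun_pair2 t (measurable_pos_rep mh)). Qed.

Lemma pos_rep_integrable (t : R) : 0 <= t ->
  m.-integrable setT (EFin \o pos_rep h t).
Proof.
move=> t0; have mht := intble_measurable (ih t0).
apply/integrableP; split; first by apply/measurable_EFinP; exact: mpos.
have /integrableP[_] := ih t0.
congr (_ < _)%E; apply: ae_eq_integral => //.
- by apply: measurableT_comp => //; exact/measurable_EFinP.
- by apply: measurableT_comp => //; apply/measurable_EFinP; exact: mpos.
- by have := ae_eq_pos_rep t0 ch; apply: filterS => x /= -> _.
Qed.

Lemma pos_rep_moment (w : T -> R) (t : R) : 0 <= t -> measurable_fun setT w ->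
  \int[m]_x (w x * h t x) = \int[m]_x (w x * pos_rep h t x).
Proof.
move=> t0 mw; apply: ae_eq_Rintegral.
- by apply: measurable_funM => //; exact: intble_measurable (ih t0).
- by apply: measurable_funM.
- by have := ae_eq_pos_rep t0 ch; apply: filterS => x ->.
Qed.

Lemma pos_rep_moment_continuous (w : T -> R) (C : R) : measurable_fun setT w ->
  (forall x, `|w x| <= C) ->
  {within `[0, +oo[, continuous (fun t => \int[m]_x (w x * pos_rep h t x))}.
Proof.
move=> mw wC; have := bounded_moment_continuous ch mw wC.
by apply: cont0_eq => t t0; rewrite pos_rep_moment.
Qed.

Lemma pos_rep_cvg (w : T -> R) (l : R) : measurable_fun setT w ->
  \int[m]_x (pos_rep h t x * w x) @[t --> +oo] --> l ->
  \int[m]_x (h t x * w x) @[t --> +oo] --> l.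
Proof.
move=> mw; apply: cvg_trans; apply: near_eq_cvg; near=> t.
have t0 : 0 <= t by near: t; apply: nbhs_pinfty_ge; rewrite num_real.
transitivity (\int[m]_x (w x * pos_rep h t x)).
  by apply: eq_Rintegral => x _; rewrite mulrC.
rewrite -(pos_rep_moment t0 mw).
by apply: eq_Rintegral => x _; rewrite mulrC.
Unshelve. all: by end_near. Qed.
End RepresentativeMoments.

Lemma Rintegral_dirac d (T : measurableType d) (R : realType) (a : T)
    (psi : T -> R) : measurable_fun setT psi ->
  \int[\d_a]_x psi x = psi a.
Proof.
move=> mpsi; rewrite /Rintegral integral_dirac//; last exact/measurable_EFinP.
by rewrite diracT mul1e.
Qed.

Unset Implicit Arguments.

Theorem theorem3 (R : realType) (lambda gamma : R)
    (f0 : R -> R) (g0 : R * R -> R) (f : R -> R -> R) (g : R -> R * R -> R) :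
  0 < lambda -> 0 < gamma ->
  (forall x, 0 <= f0 x) -> (forall p, 0 <= g0 p) ->
  measurable_fun [set: measurableTypeR R] f0 ->
  measurable_fun [set: measurableTypeR R * measurableTypeR R] g0 ->
  (\int[leb1 R]_x ((1 + x ^+ 2) * f0 x)%:E < +oo)%E ->
  (\int[leb2 R]_p ((1 + p.1 ^+ 2) * g0 p)%:E < +oo)%E ->
  (forall x y, g0 (x, y) = g0 (y, x)) ->
  let M := \int[leb1 R]_x f0 x + 2 * \int[leb2 R]_p g0 p in
  0 < M ->
  let I := \int[leb1 R]_x (x * f0 x) + 2 * \int[leb2 R]_p (p.1 * g0 p) in
  let phi_oo := I / M in
  let root := Num.sqrt (1 + 8 * lambda * M / gamma) in
  let Mf_oo := 2 * M / (1 + root) in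
  let Mg_oo := 2 * M / (1 + root) * ((2 * lambda * M / gamma) / (1 + root)) in
  mild_solution lambda gamma f0 g0 f g ->
  (forall psi : R -> R, test_function psi ->
     \int[leb1 R]_x (f t x * psi x) @[t --> +oo]
       --> Mf_oo * \int[\d_(phi_oo : measurableTypeR R)]_x psi x) /\
  (forall psi : R * R -> R, test_function psi ->
     \int[leb2 R]_p (g t p * psi p) @[t --> +oo]
       --> Mg_oo * \int[\d_((phi_oo, phi_oo) : measurableTypeR R * measurableTypeR R)]_p psi p).
Proof.
move=> l0 gm0 f00 g00 mf0 mg0 f0m g0m sym M M0 I phi_oo root Mf_oo Mg_oo.
move=> [[cf cg] mf mg [Mf [Mg [masses fE gE]]]].
have [[cMf _] _ _ Mf0 Mg0] := masses.
have ME : Mf 0 + 2 * Mg 0 = M by rewrite Mf0 Mg0.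
have M_gt0 : 0 < Mf 0 + 2 * Mg 0 by rewrite ME.
have mpf := measurable_pos_rep mf; have mpg := measurable_pos_rep mg.
have fE' := pos_rep_fE cf cg mg cMf fE.
have gE' := pos_rep_gE cf cg mf gE.
split=> psi tpsi; have [B psiB] := test_function_bounded tpsi;
  have cpsi : continuous psi := (tpsi.1 0%N).1.
- have mpsi : measurable_fun [set: measurableTypeR R] psi.
    exact: continuous_measurable_fun.
  rewrite Rintegral_dirac//; apply: (pos_rep_cvg cf) => //.
  have := @f_concentrates R lambda gamma f0 g0 (pos_rep f) (pos_rep g) Mf Mg
    l0 gm0 mf0 mg0 mpf mpg f00 g00 (pos_rep_ge0 f) (pos_rep_ge0 g) sym masses
    fE' gE' (pos_rep_integrable cf mf) (pos_rep_integrable cg mg)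
    (pos_rep_moment_continuous cf mf) (pos_rep_moment_continuous cg mg)
    f0m g0m M_gt0 psi B cpsi psiB.
  by rewrite ME.
- have mpsi := continuous_measurable_plane cpsi.
  rewrite Rintegral_dirac//; apply: (pos_rep_cvg cg) => //.
  have := @g_concentrates R lambda gamma f0 g0 (pos_rep f) (pos_rep g) Mf Mg
    l0 gm0 mf0 mg0 mpf mpg f00 g00 (pos_rep_ge0 f) (pos_rep_ge0 g) sym masses
    fE' gE' (pos_rep_integrable cf mf) (pos_rep_integrable cg mg)
    (pos_rep_moment_continuous cf mf) (pos_rep_moment_continuous cg mg)
    f0m g0m M_gt0 psi B cpsi psiB.
  by rewrite ME.
Qed.
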